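(* Let $G$ be a finite, undirected, simple graph with $n$ vertices and $m$ edges, and let $\mu_1(G)\ge \mu_2(G)\ge\cdots\ge\mu_n(G)=0$ be the eigenvalues (listed with multiplicity) of its Laplacian matrix $L(G)$. Then for every $k\in\{1,2,\dots,n-1\}$, the equality \[ \sum_{i=1}^k \mu_i(G)=m+\binom{k+1}{2} \] holds if and only if $G$ is a threshold graph with clique number $k+1$.
   Context: The Laplacian matrix of a graph $G$ is $L(G)=D(G)-A(G)$, where $D(G)$ is the diagonal matrix of vertex degrees and $A(G)$ is the adjacency matrix. It is real symmetric positive semidefinite, so its eigenvalues are real and nonnegative. A graph is called threshold if it can be constructed by an iterative process which starts with a single isolated vertex and where, at each step, either a new isolated vertex is added or a new dominating vertex (a vertex adjacent to all previous vertices) is added. The clique number of $G$ is the maximum number of vertices in a complete subgraph of $G$. *)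

(* Defs.v *)
From mathcomp Require Import all_boot all_order all_algebra.
From mathcomp Require Import reals.

Set Implicit Arguments.
Unset Strict Implicit.
Unset Printing Implicit Defensive.

Import Order.TTheory GRing.Theory Num.Theory.
Local Open Scope ring_scope.

Section Graphs.

Variables (V : finType) (e : rel V).

Definition degree (x : V) : nat := #|[set y | e x y]|.

Definition edges : {set {set V}} :=
  [set [set p.1; p.2] | p : V * V & e p.1 p.2].

Definition clique (K : {set V}) : bool :=
  [forall x in K, forall y in K, (x != y) ==> e x y].

Definition clique_number : nat := \max_(K : {set V} | clique K) #|K|.

(* [threshold_on S]: the subgraph induced by [S] is obtained from a single
   vertex by successively adding isolated or dominating vertices. *)
Inductive threshold_on : {set V} -> Prop :=
| threshold_start x : threshold_on [set x]
| threshold_isolated S x :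
    threshold_on S -> x \notin S -> (forall y, y \in S -> ~~ e x y) ->
    threshold_on (x |: S)
| threshold_dominating S x :
    threshold_on S -> x \notin S -> (forall y, y \in S -> e x y) ->
    threshold_on (x |: S).

Definition threshold : Prop := threshold_on [set: V].

(* Rows and columns are indexed by ['I_#|V|] through the enumeration of [V]. *)
Definition degree_mx (R : realType) : 'M[R]_#|V| :=
  diag_mx (\row_i (degree (enum_val i))%:R).

Definition adjacency_mx (R : realType) : 'M[R]_#|V| :=
  \matrix_(i, j) (e (enum_val i) (enum_val j))%:R.

Definition laplacian_mx (R : realType) : 'M[R]_#|V| :=
  degree_mx R - adjacency_mx R.

End Graphs.

(* [mu] lists the eigenvalues of [A] in nonincreasing order, each one repeated
   according to its multiplicity as a root of the characteristic polynomial. *)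
Definition ordered_eigenvalues (R : realType) (n : nat) (A : 'M[R]_n)
    (mu : n.-tuple R) : Prop :=
  sorted >=%R mu /\ char_poly A = \prod_(a <- mu) ('X - a%:P).

(* Main.v *)
Require Import Defs.
From mathcomp Require Import all_boot all_order all_fingroup all_algebra.
From mathcomp Require Import reals.
From mathcomp Require Import ring lra.
From mathcomp Require all_classical topology normedtype derive.

(** The key is an identity about an oblique projector. Let the rows of [Z], a
    k x n matrix, be independent, sum to 0 and span a space invariant under the
    Laplacian [L], say [Z L = Lam Z], and let [Z C = 1], so that [P = C Z] is a
    projector with [P L P = P L]. For the numbers [p u v = P u u - P v u] and
    the adjacency indicator [a], a direct computation ([gap_identity]) gives
    <<
      sum_(u, v) (p u v - a u v) (p v u - a v u) = k^2 + k + 2 m - 2 tr Lam.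
    >>
    If every [p u v] is in [0, 1], both factors of each term have the same sign,
    and [tr Lam <= m + k (k + 1) / 2] follows. Taking for [Z] the eigenvectors of
    the nonzero ones among the first [k] eigenvalues bounds their sum.

    The projector with [0 <= p u v <= 1] comes from an extremal problem. Among
    the alternating k-forms [g] bounded by 1 on all k-tuples of edge vectors
    (differences of basis vectors, signed basis vectors, and 0), take one that
    maximizes [g Z]; it exists by compactness ([exists_maximizer]). Replacing in
    turn each row of [Z] by each basis vector and dividing by [g Z] gives a right
    inverse [C] of [Z], and [p u v] is then the relative loss of [g Z] when [g]
    is pulled back along the map that collapses [u] to [v]. This pullback and
    its difference from [g] satisfy the same bounds as [g], because incidence
    matrices are totally unimodular ([edge_ball_pull], [edge_ball_sub_pull]).
    Maximality of [g Z] therefore puts [p u v] in [0, 1] ([coldrop_itv]).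

    In the case of equality all the terms vanish, for every maximizer. At an edge
    this means [p u v = 1] or [p v u = 1]; and when [p u v = 1] the difference of
    [g] and its pullback is a new maximizer, which vanishes on all tuples that
    avoid [u]. Repeating this produces a set [X] with independent complement
    and a maximizer for which [p a w = 1] whenever [a] is in [X] and [w != a]
    ([exists_concentrated_cover]). Then [X] is a clique and may be taken of size
    [k]; the invariance [P L P = P L] becomes a quadratic equation of Riccati
    type with nonnegative terms ([riccati]), and their vanishing says that the
    neighbourhoods outside [X] of the members of [X] are nested
    ([split_nested]). Such a graph is threshold, with clique number [k + 1].

    Conversely, follow the construction of a threshold graph. A dominating vertex
    [x] added to [S] adds the eigenvector [#|S| e_x - 1_S], of eigenvalue
    [#|S| + 1], and raises by 1 the eigenvalues already accounted for; an isolated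
    vertex changes nothing. After [j] dominating vertices the clique number is
    [j + 1], and an invariant space of dimension [j] has trace exactly
    [m + j (j + 1) / 2] ([threshold_eigenframe]). This trace is a sum of [j]
    eigenvalues ([invariant_trace]), so the sum of the [j] largest reaches the
    bound. *)

Set Implicit Arguments.
Unset Strict Implicit.
Unset Printing Implicit Defensive.

Import Order.TTheory GRing.Theory Num.Theory.
Local Open Scope ring_scope.

(** * Alternating forms *)

Section AlternatingForms.
Variables (R : realType) (n k : nat).
Implicit Types (g : {ffun 'I_k -> 'I_n} -> R) (F : 'I_k -> 'I_n -> R).
Implicit Types (f : {ffun 'I_k -> 'I_n}) (w : 'I_n -> R).

(** The multilinear form with coefficient array [g], applied to the k vectors
    listed by [F]. *)
Definition form g F : R := \sum_f g f * \prod_i F i (f i).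

Definition upd (T : Type) (G : 'I_k -> T) i (t : T) : 'I_k -> T :=
  fun j => if j == i then t else G j.

Definition updf f i v : {ffun 'I_k -> 'I_n} := [ffun j => upd f i v j].

Definition alternating g :=
  forall f i j, i != j -> g [ffun x => f (tperm i j x)] = - g f.

Lemma eq_form g1 g2 F1 F2 :
  g1 =1 g2 -> (forall i, F1 i =1 F2 i) -> form g1 F1 = form g2 F2.
Proof.
move=> eg eF; apply: eq_bigr => f _; rewrite eg; congr (_ * _).
by apply: eq_bigr => i _; rewrite eF.
Qed.

Lemma form_upd g F i w :
  form g (upd F i w) =
  \sum_f g f * (w (f i) * \prod_(j | j != i) F j (f j)).
Proof.
apply: eq_bigr => f _; rewrite (bigD1 i) //= /upd eqxx; congr (_ * (_ * _)).
by apply: eq_bigr => j /negbTE ->.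
Qed.

Lemma form_upd_id g F i : form g (upd F i (F i)) = form g F.
Proof. by apply: eq_form => // j x; rewrite /upd; case: eqP => [->|]. Qed.

Lemma form_linear g F i a w1 w2 :
  form g (upd F i (fun x => a * w1 x + w2 x)) =
  a * form g (upd F i w1) + form g (upd F i w2).
Proof.
rewrite !form_upd big_distrr -big_split /=; apply: eq_bigr => f _.
by rewrite mulrDl mulrDr; congr (_ + _); rewrite -mulrA mulrCA.
Qed.

Lemma form_sum g F i (I : finType) (c : I -> R) (w : I -> 'I_n -> R) :
  form g (upd F i (fun x => \sum_j c j * w j x)) =
  \sum_j c j * form g (upd F i (w j)).
Proof.
rewrite form_upd.
under [RHS]eq_bigr do rewrite form_upd big_distrr.
rewrite exchange_big /=; apply: eq_bigr => f _.
rewrite mulr_suml big_distrr /=; apply: eq_bigr => j _.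
by rewrite -mulrA mulrCA.
Qed.

Lemma form_alt g F i j :
  alternating g -> i != j -> F i =1 F j -> form g F = 0.
Proof.
move=> alt_g ij eF.
have : form g F = - form g F.
  rewrite {1}/form (reindex_inj (h := fun f => [ffun x => f (tperm i j x)])).
    rewrite -sumrN; apply: eq_bigr => f _; rewrite alt_g // mulNr.
    congr (- (_ * _)); rewrite (reindex_inj (perm_inj (s := tperm i j))) /=.
    apply: eq_bigr => x _; rewrite ffunE tpermK.
    by case: tpermP => [->|->|//]; rewrite eF.
  move=> f1 f2 /ffunP e; apply/ffunP => x.
  by have := e (tperm i j x); rewrite !ffunE tpermK.
by move/eqP; rewrite -addr_eq0 -mulr2n mulrn_eq0 => /eqP.
Qed.

Lemma form_rowop g F i j c : alternating g -> i != j ->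
  form g (upd F j (fun x => c * F i x + F j x)) = form g F.
Proof.
move=> alt_g ij; rewrite form_linear form_upd_id.
rewrite (form_alt (i := i) (j := j)) ?mulr0 ?add0r // => x.
by rewrite /upd eqxx (negbTE ij).
Qed.

(** As for determinants. This is how a given coordinate is cleared in all
    arguments but one. *)
Lemma form_rowops g F i0 (c : 'I_k -> R) : alternating g ->
  form g (fun j x => if j == i0 then F j x else c j * F i0 x + F j x) =
  form g F.
Proof.
move=> alt_g.
pose G (J : seq 'I_k) j x :=
  if j \in J then c j * F i0 x + F j x else F j x.
suff H J : uniq J -> i0 \notin J -> form g (G J) = form g F.
  rewrite -(H [seq j <- enum 'I_k | j != i0]); first 1 last.
  - by rewrite filter_uniq // enum_uniq.
  - by rewrite mem_filter eqxx.
  apply: eq_form => // j x; rewrite /G mem_filter mem_enum /=.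
  by case: (j == i0).
elim: J => [|j J IH] /=; first by move=> _ _; apply: eq_form.
rewrite inE negb_or => /andP[jJ uJ] /andP[ij iJ]; rewrite -(IH uJ iJ).
rewrite -(form_rowop (G J) (c j) alt_g ij); apply: eq_form => // a x.
rewrite /upd /G inE; case: (eqVneq a j) => [->|_] //=.
by rewrite (negbTE iJ) (negbTE jJ).
Qed.

Lemma alt_noninj g f i j : alternating g -> i != j -> f i = f j -> g f = 0.
Proof.
move=> alt_g ij fij; have : g f = - g f.
  rewrite -(alt_g f i j ij); congr g; apply/ffunP => x; rewrite ffunE.
  by case: tpermP => [->|->|].
by move/eqP; rewrite -addr_eq0 -mulr2n mulrn_eq0 => /eqP.
Qed.

Definition collapse u v (x : 'I_n) := if x == u then v else x.
(** Pullback along the linear map that sends the basis vector of [u] to that of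
    [v] and fixes the other basis vectors. *)
Definition pull u v g : {ffun 'I_k -> 'I_n} -> R :=
  fun f => g [ffun i => collapse u v (f i)].

Lemma alternating_pull u v g : alternating g -> alternating (pull u v g).
Proof.
move=> alt_g f i j ij; rewrite /pull -(alt_g _ i j ij).
by congr g; apply/ffunP => x; rewrite !ffunE.
Qed.

Lemma alternatingB g1 g2 :
  alternating g1 -> alternating g2 -> alternating (fun f => g1 f - g2 f).
Proof. by move=> h1 h2 f i j ij; rewrite h1 // h2 // opprD. Qed.

Lemma formB g1 g2 F : form (fun f => g1 f - g2 f) F = form g1 F - form g2 F.
Proof. by rewrite /form -sumrB; apply: eq_bigr => f _; rewrite mulrBl. Qed.

Definition push u v (w : 'I_n -> R) : 'I_n -> R :=
  fun x => \sum_(y | collapse u v y == x) w y.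

Lemma form_pull u v g F : form (pull u v g) F = form g (fun i => push u v (F i)).
Proof.
rewrite /form.
under [RHS]eq_bigr => f _.
  rewrite /push (bigA_distr_big_dep (fun i y => collapse u v y == f i)) /=.
  over.
rewrite (partition_big (fun f => [ffun i => collapse u v (f i)]) predT) //=.
apply: eq_bigr => h _; rewrite big_distrr /=.
apply: eq_big => [f|f /eqP <- //].
apply/eqP/familyP => [<- i|e]; first by rewrite /in_mem /= ffunE.
by apply/ffunP => i; rewrite ffunE; apply/eqP; exact: e i.
Qed.

(** An alternating array vanishes on tuples with a repeated entry. If [u] occurs
    once in [f], the sum has a single term; if it occurs twice, the two tuples
    obtained differ by a transposition and cancel; if it occurs more often, all
    terms vanish. *)
Lemma pull_expand u v g f : alternating g ->
  g f - pull u v g f = \sum_(i | f i == u) (g f - g (updf f i v)).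
Proof.
move=> alt_g; rewrite /pull.
case: (pickP [pred i | f i == u]) => [i0 /= /eqP fi0|no]; last first.
  rewrite big_pred0 // (_ : [ffun i => _] = f) ?subrr //.
  by apply/ffunP => i; rewrite ffunE /collapse; have := no i => /= ->.
rewrite (bigD1 i0) ?fi0 //=.
case: (pickP [pred i | (f i == u) && (i != i0)]) => [j0 /= /andP[/eqP fj0 ji0]|no].
  have gf0 : g f = 0 by rewrite (alt_noninj (i := j0) (j := i0)) ?fi0 ?fj0.
  rewrite (bigD1 j0) /=; last by apply/andP; split=> //; apply/eqP.
  rewrite big1 ?addr0; last first.
    move=> i /andP[/andP[/eqP fi ii0] ij0].
    rewrite gf0 (alt_noninj (f := updf f i v) (i := j0) (j := i0)) ?subrr //.
    by rewrite !ffunE /upd ![_ == i]eq_sym (negbTE ii0) (negbTE ij0) fi0 fj0.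
  rewrite gf0 (alt_noninj (i := j0) (j := i0)) ?ffunE ?fi0 ?fj0 // !sub0r.
  rewrite oppr0 -opprD; apply/eqP; rewrite eq_sym oppr_eq0 addr_eq0 -(alt_g _ j0 i0) //.
  apply/eqP; congr g; apply/ffunP => x; rewrite !ffunE /upd.
  case: tpermP => [->|->|/eqP/negbTE -> /eqP/negbTE ->] //.
  - by rewrite [i0 == _]eq_sym (negbTE ji0) fi0.
  - by rewrite !eqxx.
rewrite big_pred0 ?addr0; last by move=> i; have := no i.
congr (_ - g _); apply/ffunP => x; rewrite !ffunE /upd /collapse.
have := no x => /=; case: (eqVneq x i0) => [->|_]; first by rewrite fi0 eqxx.
by rewrite andbT => ->.
Qed.

Definition unitv (v : 'I_n) : 'I_n -> R := fun x => (x == v)%:R.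

(** The difference is of first order in the [u]-coordinates of the arguments:
    by [pull_expand] only one argument at a time is moved from [u] to [v]. *)
Lemma form_sub_pull u v g F : alternating g ->
  form g F - form (pull u v g) F =
  \sum_i F i u * (form g (upd F i (unitv u)) - form g (upd F i (unitv v))).
Proof.
move=> alt_g; rewrite -formB {1}/form.
under eq_bigr => f _ do rewrite (pull_expand u v f alt_g) mulr_suml big_mkcond /=.
rewrite exchange_big /=; apply: eq_bigr => i _.
rewrite !form_upd mulrBr !big_distrr /=.
rewrite [X in _ = _ - X]
  (reindex_inj (h := fun f => updf f i (tperm u v (f i)))); last first.
  move=> f1 f2 /ffunP e; apply/ffunP => x; have := e x; rewrite !ffunE /upd.
  by case: eqP => [->|//] /perm_inj.
rewrite -sumrB; apply: eq_bigr => f _.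
have -> : \prod_(j < k | j != i) F j (updf f i (tperm u v (f i)) j) =
          \prod_(j < k | j != i) F j (f j).
  by apply: eq_bigr => j ji; rewrite !ffunE /upd (negbTE ji).
have -> : updf f i (tperm u v (f i)) i = tperm u v (f i).
  by rewrite ffunE /upd eqxx.
rewrite /unitv -[X in tperm u v (f i) == X](tpermL u v) (inj_eq perm_inj).
case: eqP => [fu|_]; last by rewrite !(mul0r, mulr0) subrr.
rewrite !mul1r fu tpermL mulrBl (bigD1 i) //= fu.
by congr (_ - _); rewrite mulrCA.
Qed.

End AlternatingForms.

(** * Forms bounded on edge vectors *)

Section EdgeBall.
Variables (R : realType) (n k : nat).
Implicit Types (g : {ffun 'I_k -> 'I_n} -> R) (F : 'I_k -> 'I_n -> R).
Implicit Types (f : {ffun 'I_k -> 'I_n}) (w r : 'I_n -> R).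

(** Columns of incidence matrices, with [None] as a ground vertex: differences
    of basis vectors, signed basis vectors, and 0. *)
Definition edgev (s t : option 'I_n) : 'I_n -> R :=
  fun x => (s == Some x)%:R - (t == Some x)%:R.

Definition is_edge w := exists s t, w =1 edgev s t.

(** Bounding the values on edge vectors makes this set stable both under
    [pull u v] and under [g |-> g - pull u v g]. *)
Definition edge_ball g := alternating g /\
  forall st : {ffun 'I_k -> option 'I_n * option 'I_n},
    `|form g (fun i => edgev (st i).1 (st i).2)| <= 1.

Lemma edge_ball_form g F :
  edge_ball g -> (forall i, is_edge (F i)) -> `|form g F| <= 1.
Proof.
move=> [_ bg] /fin_all_exists[s /fin_all_exists[t eF]].
have := bg [ffun i => (s i, t i)]; congr (`|_| <= _).
by apply: eq_form => // i x; rewrite ffunE /= eF.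
Qed.

Lemma pushE u v w x :
  push u v w x = w x + w u * (unitv R v x - unitv R u x).
Proof.
rewrite /push /unitv big_mkcond (bigD1 u) //= {1}/collapse eqxx.
have -> : \sum_(i < n | i != u) (if collapse u v i == x then w i else 0) =
          w x - w u * (x == u)%:R.
  under eq_bigr => i iu do rewrite /collapse (negbTE iu).
  rewrite -big_mkcondr /=; case: (eqVneq x u) => [->|xu].
    rewrite big_pred0 ?mulr1 ?subrr // => i.
    by case: eqP.
  rewrite mulr0 subr0 (bigD1 x) /= ?xu ?eqxx // big1 ?addr0 // => i.
  by case/andP => /andP[_ /eqP ->]; rewrite eqxx.
by rewrite [v == x]eq_sym; case: (x == v); case: (x == u) => /=; ring.
Qed.

(** Collapsing [u] to [v] maps edges to edges, or to loops, whose vector is 0. *)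
Lemma push_edge u v w : is_edge w -> is_edge (push u v w).
Proof.
move=> [s [t ew]]; exists (omap (collapse u v) s), (omap (collapse u v) t) => x.
have pi (o : option 'I_n) : \sum_(y | collapse u v y == x) (o == Some y)%:R =
    (omap (collapse u v) o == Some x)%:R :> R.
  case: o => [z|] /=; last by rewrite big1.
  rewrite (_ : (Some _ == Some x) = (collapse u v z == x)) //.
  case: eqP => [czx|ne]; last first.
    rewrite big1 // => y /eqP cy; case: eqP => [[zy]|] //.
    by case: ne; rewrite zy.
  rewrite (bigD1 z) /= ?czx ?eqxx // big1 ?addr0 // => y /andP[_ yz].
  by rewrite (_ : (Some z == Some y) = (z == y)) // eq_sym (negbTE yz).
rewrite /push; under eq_bigr do rewrite ew /edgev.
by rewrite sumrB !pi.
Qed.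

(** Total unimodularity of incidence matrices: pivoting at a nonzero entry of an
    edge vector turns edge vectors into edge vectors. *)
Lemma edge_reduce u w r : is_edge w -> is_edge r -> r u != 0 ->
  is_edge (fun x => - (w u / r u) * r x + w x).
Proof.
move=> [s [t ew]] [s' [t' er]]; rewrite ew er /edgev.
case: (eqVneq s' (Some u)) => [s'u|s'u]; case: (eqVneq t' (Some u)) => [t'u|t'u];
  rewrite /= ?subrr ?eqxx ?(subr0, sub0r) // => _;
  case: (eqVneq s (Some u)) => [su|su]; case: (eqVneq t (Some u)) => [tu|tu];
  rewrite /= ?subrr ?subr0 ?sub0r.
- by exists s, t => x; rewrite ew er mul0r oppr0 mul0r add0r.
- by exists t', t => x; rewrite ew er /edgev s'u su divr1 !mulN1r; ring.
- by exists s, t' => x; rewrite ew er /edgev s'u tu; field.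
- by exists s, t => x; rewrite ew er mul0r oppr0 mul0r add0r.
- by exists s, t => x; rewrite ew er mul0r oppr0 mul0r add0r.
- by exists s', t => x; rewrite ew er /edgev t'u su; field.
- by exists s, s' => x; rewrite ew er /edgev t'u tu; field.
- by exists s, t => x; rewrite ew er mul0r oppr0 mul0r add0r.
Qed.

Lemma edge_ball_pull u v g : edge_ball g -> edge_ball (pull u v g).
Proof.
move=> bg; split; first exact/alternating_pull/bg.1.
move=> st; rewrite form_pull; apply: edge_ball_form => // i.
by apply: push_edge; do 2!eexists.
Qed.

(** After pivoting, a single argument has a nonzero [u]-coordinate, equal to 1
    or -1. Collapsing [u] to [v] changes this argument only, by an edge vector
    between [u] and [v]; by linearity the difference of the two values is again a
    value of [g] on edge vectors. *)
Lemma edge_ball_sub_pull u v g :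
  edge_ball g -> edge_ball (fun f => g f - pull u v g f).
Proof.
move=> bg; have [alt_g _] := bg.
split; first exact/alternatingB/alternating_pull.
move=> st; set F := fun i => edgev _ _.
have eF i : is_edge (F i) by do 2!eexists.
have alt_p : alternating (pull u v g) by exact: alternating_pull.
rewrite formB.
(* The pivot is row [i0]; without one, the collapse fixes all arguments. *)
case: (pickP [pred i | F i u != 0]) => [i0 /= Fi0|no]; last first.
  rewrite form_pull (eq_form (g1 := g) (g2 := g)
    (F1 := fun i => push u v (F i)) (F2 := F)) ?subrr ?normr0 //.
  by move=> i x; rewrite pushE; have /negbFE/eqP -> := no i; rewrite mul0r addr0.
rewrite -(form_rowops F i0 (fun j => - (F j u / F i0 u)) alt_g).
rewrite -(form_rowops F i0 (fun j => - (F j u / F i0 u)) alt_p).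
set G := fun j x => _.
have eG i : is_edge (G i).
  by rewrite /G; case: eqP => // _; apply: edge_reduce.
have Gi0 : G i0 =1 F i0 by move=> x; rewrite /G eqxx.
rewrite form_pull (eq_form (g1 := g) (g2 := g) (F1 := fun i => push u v (G i))
   (F2 := upd G i0 (fun x => F i0 u * (unitv R v x - unitv R u x) + G i0 x))) //;
   last first.
  move=> j x; rewrite [LHS]pushE /upd; case: (eqVneq j i0) => [->|ji].
    by rewrite addrC Gi0.
  by rewrite {2}/G (negbTE ji) mulNr divfK // addNr mul0r addr0.
rewrite form_linear form_upd_id opprD addrCA subrr addr0 normrN normrM.
have [s [t es]] := eF i0.
have -> : `|F i0 u| = 1.
  move: Fi0; rewrite es /edgev; case: (s == _); case: (t == _);
  by rewrite /= ?subrr ?eqxx ?subr0 ?sub0r ?normrN ?normr1 ?normr0.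
rewrite mul1r; apply: edge_ball_form => // i; rewrite /upd; case: eqP => // _.
by exists (Some v), (Some u) => x; rewrite /unitv /edgev ![_ == Some x]eq_sym.
Qed.

End EdgeBall.

(** * Maximizing forms *)

Section Maximizer.
Import mathcomp.classical.all_classical topology normedtype derive.
Import numFieldNormedType.Exports.

Variables (R : realType) (n k : nat).
Implicit Types (g : {ffun 'I_k -> 'I_n} -> R) (F : 'I_k -> 'I_n -> R).

Definition maximizer (Z : 'M[R]_(k, n)) g := [/\ edge_ball g, 0 < form g Z &
  forall h, edge_ball h -> form h Z <= form g Z].

(** The expansion of [\det (Z *m B)] along the rows of [Z], which exhibits
    [F |-> \det (F *m B)] as an alternating form. *)
Lemma form_det (B : 'M[R]_(n, k)) (Z : 'M[R]_(k, n)) :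
  form (fun f => \det (\matrix_(i, j) B (f i) j)) Z = \det (Z *m B).
Proof.
rewrite /form /determinant; under eq_bigr do rewrite big_distrl /=.
rewrite exchange_big /=; apply: eq_bigr => s _.
under [in RHS]eq_bigr do rewrite mxE.
rewrite bigA_distr_bigA /= big_distrr /=; apply: eq_bigr => f _.
rewrite -mulrA -big_split /=; congr (_ * _); apply: eq_bigr => i _.
by rewrite mxE mulrC.
Qed.

Lemma alternating_det (B : 'M[R]_(n, k)) :
  alternating (fun f : {ffun 'I_k -> 'I_n} => \det (\matrix_(i, j) B (f i) j)).
Proof.
move=> f i j ij; set M := \matrix_(a, b) B (f a) b.
rewrite (_ : \matrix_(a, b) _ = row_perm (tperm i j) M).
  by rewrite row_permE det_mulmx det_perm odd_tperm ij expr1 mulN1r.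
by apply/matrixP => a b; rewrite !mxE ffunE.
Qed.

(** When [Z *m B = 1] the form [F |-> \det (F *m B)] equals 1 at [Z]; dividing it
    by a bound for its values on the finitely many tuples of edge vectors brings
    it into the ball. *)
Lemma exists_edge_ball_gt0 (Z : 'M[R]_(k, n)) : row_free Z ->
  exists2 g, edge_ball g & 0 < form g Z.
Proof.
move=> /row_freeP[B ZB].
pose g (f : {ffun 'I_k -> 'I_n}) := \det (\matrix_(i, j) B (f i) j).
pose N (st : {ffun 'I_k -> option 'I_n * option 'I_n}) :=
  `|form g (fun i => edgev R (st i).1 (st i).2)|.
(* The summand 1 keeps [K] positive when all these values are 0. *)
pose K := 1 + \sum_st N st.
have N_ge0 st : 0 <= N st by exact: normr_ge0.
have K_gt0 : 0 < K by rewrite ltr_wpDr ?ltr01 // sumr_ge0.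
have scale F : form (fun f => K^-1 * g f) F = K^-1 * form g F.
  by rewrite /form big_distrr /=; apply: eq_bigr => f _; rewrite mulrA.
exists (fun f => K^-1 * g f); last first.
  by rewrite scale /g form_det ZB det1 mulr1 invr_gt0.
split; first by move=> f i j ij; rewrite /g alternating_det // mulrN.
move=> st; rewrite scale normrM gtr0_norm ?invr_gt0 // mulrC.
rewrite ler_pdivrMr // mul1r -/(N st) /K (bigD1 st) //= addrCA lerDl.
by rewrite addr_ge0 // sumr_ge0.
Qed.

Local Notation N := #|{ffun 'I_k -> 'I_n}|.

(** Arrays are transported to row vectors, on which compactness is available in
    the form of closed and bounded sets. *)
Definition cochain (x : 'rV[R]_N) : {ffun 'I_k -> 'I_n} -> R :=
  fun f => x ord0 (enum_rank f).

Lemma form_cochain_continuous F : continuous (fun x => form (cochain x) F).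
Proof.
rewrite /form; move: (index_enum _); elim=> [|f s IH] x.
  rewrite (_ : (fun _ => _) = fun=> 0); first exact: cst_continuous.
  by apply/funext => y; rewrite big_nil.
rewrite (_ : (fun _ => _) = fun x => cochain x f * \prod_i F i (f i) +
  \sum_(h <- s) cochain x h * \prod_i F i (h i)); last first.
  by apply/funext => y; rewrite big_cons.
have cx : (cochain y f @[y --> x] --> cochain x f)%classic.
  exact: coord_continuous.
exact: (cvgD (cvgMr_tmp cx) (IH x)).
Qed.

(** The entries of an array are among its values on edge vectors, so that those
    of a member of the ball lie in [-1, 1]. *)
Lemma form_single g (f : {ffun 'I_k -> 'I_n}) :
  form g (fun i => edgev R (Some (f i)) None) = g f.
Proof.
rewrite /form (bigD1 f) //= big1 => [|i _]; last first.
  by rewrite /edgev eqxx subr0.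
rewrite mulr1 big1 ?addr0 // => h hf.
have [i fhi] : exists i, f i != h i.
  apply/existsP; rewrite -negb_forall; apply: contra hf => /forallP e.
  by apply/eqP/ffunP => i; apply/esym/eqP.
rewrite (bigD1 i) //= /edgev (_ : (Some _ == Some _) = (f i == h i)) //.
by rewrite (negbTE fhi) subr0 mul0r mulr0.
Qed.

Lemma edge_ball_compact : compact [set x | edge_ball (cochain x)]%classic.
Proof.
apply: (@subclosed_compact _ _
  [set x : 'rV[R]_N | forall i, `[-1, 1]%classic (x ord0 i)]%classic).
- rewrite (_ : mkset _ =
    (\bigcap_(p in [set: {ffun 'I_k -> 'I_n} * ('I_k * 'I_k)])
       [set x | p.2.1 != p.2.2 ->
          cochain x [ffun a => p.1 (tperm p.2.1 p.2.2 a)] + cochain x p.1 = 0%R]) `&`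
    (\bigcap_(st in [set: {ffun 'I_k -> option 'I_n * option 'I_n}])
       [set x | `|form (cochain x) (fun i => edgev R (st i).1 (st i).2)| <= 1]))%classic.
    apply: closedI; [apply: closed_bigI => -[f [i j]] _ /=|
      apply: closed_bigI => st _ /=].
      case: (eqVneq i j) => [_|ij].
        rewrite (_ : mkset _ = setT); first exact: closedT.
        by apply/seteqP; split.
      rewrite (_ : mkset _ = (fun x => cochain x [ffun a => f (tperm i j a)] +
        cochain x f) @^-1` [set y | y = 0%R])%classic; last first.
        by apply/seteqP; split => x /=; [apply | move=> ->].
      apply: preimage_closed; last exact: closed_eq.
      move=> x _; have cx h : (cochain y h @[y --> x] --> cochain x h)%classic.
        exact: coord_continuous.
      exact: (cvgD (cx _) (cx _)).
    apply: (@preimage_closed _ _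
      (fun x => `|form (cochain x) (fun i => edgev R (st i).1 (st i).2)|)
      [set y | y <= 1]%classic); last exact: closed_le.
    move=> x _; apply: (@continuous_comp _ _ _ (fun x => form (cochain x) _)
       (fun y : R => `|y|)); first exact: form_cochain_continuous.
    exact: norm_continuous.
  apply/seteqP; split => x /=.
    move=> [alt bd]; split=> [[f [i j]] _ /= ij|st _ /=]; last exact: bd.
    by rewrite alt // addNr.
  move=> [alt bd]; split=> [f i j ij|st]; last exact: bd.
  by apply/eqP; rewrite -addr_eq0; apply/eqP; apply: (alt (f, (i, j))).
- apply: (@rV_compact R _ (fun=> `[-1, 1]%classic)) => _.
  exact: segment_compact.
- move=> x /= bx i; rewrite /= in_itv /= -ler_norml.
  rewrite -[i]enum_valK -[x _ _]/(cochain x _) -form_single.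
  by apply: edge_ball_form => // j; do 2!eexists.
Qed.

Lemma exists_maximizer (Z : 'M[R]_(k, n)) : row_free Z ->
  exists g, maximizer Z g.
Proof.
move=> /exists_edge_ball_gt0[g0 bg0 g0Z].
have tochain g : exists x, cochain x =1 g.
  by exists (\row_i g (enum_val i)) => f; rewrite /cochain mxE enum_rankK.
have ball_ext g h : g =1 h -> edge_ball g -> edge_ball h.
  move=> e [ag bg]; split=> [f i j ij|st]; first by rewrite -!e ag.
  by rewrite -(eq_form (g1 := g) e (fun i => frefl _)).
have [x0 ex0] := tochain g0.
have [||x] := EVT_max_rV (f := fun x => form (cochain x) Z) _ edge_ball_compact.
- by exists x0 => /=; apply: ball_ext bg0 => f; rewrite ex0.
- exact/continuous_subspaceT/form_cochain_continuous.
rewrite inE /= => bx maxx; exists (cochain x).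
have max h : edge_ball h -> form h Z <= form (cochain x) Z.
  have [y ey] := tochain h => bh.
  rewrite -(eq_form ey (fun i => frefl (Z i))); apply: maxx.
  by rewrite inE /=; apply: ball_ext bh => f; rewrite ey.
by split=> //; apply: lt_le_trans g0Z (max _ bg0).
Qed.

End Maximizer.

(** * The oblique projector of a maximizing form *)

Section Projector.
Variables (R : realType) (n k : nat) (Z : 'M[R]_(k, n)).
Implicit Types (g : {ffun 'I_k -> 'I_n} -> R).

(** For the form [F |-> \det (F *m B)] with [Z *m B = 1] this is [B], by Cramer's
    rule. *)
Definition coframe g : 'M[R]_(n, k) :=
  \matrix_(v, i) (form g (upd Z i (unitv R v)) / form g Z).

(** In the projector of a maximizer these numbers lie in [0, 1] and act as a
    fractional orientation of the pairs [u], [v], to be compared with the edges of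
    the graph. *)
Definition coldrop (Pi : 'M[R]_n) u v := Pi u u - Pi v u.

(** By linearity the entry (j, i) of the product is the value of [g], relative to
    [form g Z], at [Z] with row [i] replaced by row [j]. *)
Lemma mul_coframe g : alternating g -> form g Z != 0 -> Z *m coframe g = 1%:M.
Proof.
move=> alt_g gZ; apply/matrixP => j i; rewrite !mxE.
under eq_bigr do rewrite mxE mulrA.
rewrite -mulr_suml -form_sum.
rewrite (eq_form (g2 := g) (F2 := upd Z i (Z j))) //; last first.
  move=> a x; rewrite /upd; case: eqP => // _.
  rewrite (bigD1 x) //= /unitv eqxx mulr1 big1 ?addr0 // => y.
  by rewrite eq_sym => /negbTE ->; rewrite mulr0.
case: (eqVneq j i) => [->|ji]; first by rewrite form_upd_id divff.
rewrite (form_alt (i := i) (j := j)) ?mul0r // 1?eq_sym // => x.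
by rewrite /upd eqxx (negbTE ji).
Qed.

Lemma coldrop_coframe g u v : alternating g ->
  coldrop (coframe g *m Z) u v = (form g Z - form (pull u v g) Z) / form g Z.
Proof.
move=> alt_g; rewrite form_sub_pull // /coldrop !mxE -sumrB mulr_suml.
by apply: eq_bigr => i _; rewrite !mxE; ring.
Qed.

(** The values at [Z] of [pull u v g] and of [g - pull u v g], both of which
    stay in the ball, do not exceed the maximum [form g Z]. *)
Lemma coldrop_itv g u v : maximizer Z g -> 0 <= coldrop (coframe g *m Z) u v <= 1.
Proof.
move=> [bg g0 gmax]; have [alt_g _] := bg.
rewrite coldrop_coframe //; apply/andP; split.
  by rewrite divr_ge0 ?(ltW g0) // subr_ge0; apply/gmax/edge_ball_pull.
by rewrite ler_pdivrMr // mul1r -formB; apply/gmax/edge_ball_sub_pull.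
Qed.

(** For such [g] the pullback [pull u w g] is 0 whenever [w != u]. *)
Definition concentrated g u :=
  forall f : {ffun 'I_k -> 'I_n}, (forall i, f i != u) -> g f = 0.

Lemma concentrated_coldrop g u w : maximizer Z g -> concentrated g u -> w != u ->
  coldrop (coframe g *m Z) u w = 1.
Proof.
move=> [[alt_g _] g0 _] gu wu; rewrite coldrop_coframe // [form (pull _ _ _) _]big1.
  by rewrite subr0 divff ?gt_eqF.
move=> f _; rewrite /pull gu ?mul0r // => i; rewrite ffunE /collapse.
by case: ifP => // /negbT.
Qed.

(** A drop equal to 1 says that [pull u v g] vanishes at [Z], so that removing
    it from [g] loses nothing of the maximum. *)
Lemma maximizer_push g u v : maximizer Z g ->
  coldrop (coframe g *m Z) u v = 1 -> maximizer Z (fun f => g f - pull u v g f).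
Proof.
move=> [bg g0 gmax]; have [alt_g _] := bg; rewrite coldrop_coframe // => e.
have {}e : form g Z - form (pull u v g) Z = form g Z.
  exact: divr1_eq e.
by split; rewrite ?formB ?e //; exact: edge_ball_sub_pull.
Qed.

Lemma concentrated_push g u v : concentrated (fun f => g f - pull u v g f) u.
Proof.
move=> f fu; apply/eqP; rewrite subr_eq0 /pull; apply/eqP; congr g.
by apply/ffunP => i; rewrite ffunE /collapse (negbTE (fu i)).
Qed.

Lemma concentrated_push_other g u v x : x != v -> concentrated g x ->
  concentrated (fun f => g f - pull u v g f) x.
Proof.
move=> xv gx f fx; rewrite gx // sub0r /pull gx ?oppr0 // => i.
by rewrite ffunE /collapse; case: ifP => _; rewrite // eq_sym.
Qed.

(** As long as an edge joins two vertices outside the set [X] of known points of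
    concentration, one of its drops is 1, and replacing [g] by [g - pull u v g]
    adds [u] to [X] without affecting the other members. *)
Lemma exists_concentrated_cover (e : rel 'I_n) : row_free Z -> irreflexive e ->
  (forall g u v, maximizer Z g -> e u v ->
     coldrop (coframe g *m Z) u v = 1 \/ coldrop (coframe g *m Z) v u = 1) ->
  exists g (X : {set 'I_n}), [/\ maximizer Z g, forall x, x \in X -> concentrated g x
    & forall u v, u \notin X -> v \notin X -> ~~ e u v].
Proof.
move=> fZ e_irr e_drop.
have [g mg] := exists_maximizer fZ.
suff H m (X : {set 'I_n}) h : (#|~: X| <= m)%N -> maximizer Z h ->
    (forall x, x \in X -> concentrated h x) -> exists g (X : {set 'I_n}),
    [/\ maximizer Z g, forall x, x \in X -> concentrated g x
      & forall u v, u \notin X -> v \notin X -> ~~ e u v].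
  by apply: (H _ set0 g (leqnn _) mg) => x; rewrite inE.
elim: m X h => [|m IH] X h Xm mh fh.
  exists h, X; split=> // u v uX; move: Xm; rewrite leqn0 cards_eq0 => /eqP X0.
  by have := in_set0 u; rewrite -X0 inE uX.
case: (boolP [exists u, exists v, [&& u \notin X, v \notin X & e u v]]).
  move=> /existsP[u0 /existsP[v0 /and3P[uX0 vX0 euv]]].
  have uv0 : u0 != v0 by apply: contraL euv => /eqP ->; rewrite e_irr.
  have [u [v [uX vX uv huv]]] : exists u v, [/\ u \notin X, v \notin X, u != v
      & coldrop (coframe h *m Z) u v = 1].
    have [d|d] := e_drop h u0 v0 mh euv; first by exists u0, v0.
    by exists v0, u0; rewrite eq_sym.
  apply: (IH (u |: X) (fun f => h f - pull u v h f)).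
  - move: Xm; rewrite [~: X](_ : _ = u |: ~: (u |: X)).
      by rewrite cardsU1 !inE eqxx.
    by apply/setP => x; rewrite !inE; case: eqP => [->|].
  - exact: maximizer_push.
  - move=> x; rewrite in_setU1 => /orP[/eqP ->|xX]; first exact: concentrated_push.
    apply: concentrated_push_other; last exact: fh.
    by apply: contraNneq vX => <-.
rewrite negb_exists => /forallP no; exists h, X; split=> // u v uX vX.
by have := no u; rewrite negb_exists => /forallP/(_ v); rewrite uX vX.
Qed.

End Projector.

(** * The gap identity *)

Lemma sum_pick (R : realType) n (F : 'I_n -> R) i :
  \sum_j (i == j)%:R * F j = F i.
Proof.
rewrite (bigD1 i) //= eqxx mul1r big1 ?addr0 // => j.
by rewrite eq_sym => /negbTE ->; rewrite mul0r.
Qed.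

Section Gap.
Variables (R : realType) (n k : nat) (e : rel 'I_n).
Hypotheses (e_sym : symmetric e) (e_irr : irreflexive e).

Definition laplacian : 'M[R]_n :=
  \matrix_(i, j) ((i == j)%:R * \sum_x (e i x)%:R - (e i j)%:R).

Lemma laplacian_sum0 i : \sum_j laplacian i j = 0.
Proof.
under eq_bigr do rewrite mxE.
by rewrite sumrB (sum_pick (fun=> _)) subrr.
Qed.

Variables (Z : 'M[R]_(k, n)) (Lam : 'M[R]_k).
Hypotheses (ZL : Z *m laplacian = Lam *m Z) (Z0 : forall i, \sum_v Z i v = 0).

Section Frame.
Variables (C : 'M[R]_(n, k)).
Hypothesis ZC : Z *m C = 1%:M.
Let Pi := C *m Z.
Local Notation d := (coldrop Pi).

Lemma frame_idem : Pi *m Pi = Pi.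
Proof. by rewrite /Pi mulmxA -(mulmxA C) ZC mulmx1. Qed.

Lemma frame_trace : \sum_u Pi u u = k%:R.
Proof. by rewrite -/(\tr Pi) /Pi mxtrace_mulC ZC mxtrace1. Qed.

Lemma frame_row u : \sum_v Pi u v = 0.
Proof.
under eq_bigr do rewrite mxE.
rewrite exchange_big /= big1 // => i _.
by rewrite -mulr_sumr Z0 mulr0.
Qed.

Lemma sum_coldrop v : \sum_u d u v = k%:R.
Proof. by rewrite sumrB frame_trace frame_row subr0. Qed.

Lemma coldrop_diag u : d u u = 0. Proof. by rewrite /coldrop subrr. Qed.

(** Expanding the product leaves two sums: the square of the trace [k] of the
    projector, and the trace of its square. The mixed ones vanish because the
    rows of the projector sum to 0. *)
Lemma sum_coldrop_mul : \sum_u \sum_v d u v * d v u = k%:R ^+ 2 + k%:R.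
Proof.
have -> : \sum_u \sum_v d u v * d v u = \sum_u \sum_v Pi u u * Pi v v -
   (\sum_u \sum_v Pi u u * Pi u v + \sum_u \sum_v Pi v u * Pi v v) +
   \sum_u \sum_v Pi u v * Pi v u.
  rewrite -big_split -sumrB -big_split; apply: eq_bigr => u _ /=.
  rewrite -big_split -sumrB -big_split; apply: eq_bigr => v _ /=.
  by rewrite /coldrop; ring.
rewrite [X in _ - (_ + X)]exchange_big /=.
have -> : \sum_u \sum_v Pi u u * Pi v v = k%:R ^+ 2.
  under eq_bigr do rewrite -mulr_sumr frame_trace.
  by rewrite -mulr_suml frame_trace expr2.
have -> : \sum_u \sum_v Pi u u * Pi u v = 0.
  by rewrite big1 // => u _; rewrite -mulr_sumr frame_row mulr0.
have -> : \sum_j \sum_i Pi j i * Pi j j = 0.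
  by rewrite big1 // => u _; rewrite -mulr_suml frame_row mul0r.
rewrite addr0 subr0; congr (_ + _); rewrite -[in RHS]frame_trace.
by apply: eq_bigr => u _; rewrite -[in RHS]frame_idem [in RHS]mxE.
Qed.

(** The left side is the trace of the Laplacian times [C *m Z], and [C] can be
    cycled to meet [Z] once [ZL] has moved the Laplacian out of the way. *)
Lemma sum_edge_coldrop : \sum_u \sum_v (e u v)%:R * d u v = \tr Lam.
Proof.
have -> : \tr Lam = \tr (laplacian *m Pi).
  by rewrite /Pi mulmxA mxtrace_mulC mulmxA ZL -mulmxA ZC mulmx1.
rewrite /mxtrace; apply: eq_bigr => u _; rewrite mxE.
under [RHS]eq_bigr do rewrite mxE mulrBl.
rewrite sumrB; under [in RHS]eq_bigr do rewrite -mulrA.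
rewrite (sum_pick (fun j => _ * Pi j u)).
by rewrite mulr_suml -sumrB; apply: eq_bigr => v _; rewrite mulrBr.
Qed.

Lemma gap_identity :
  \sum_u \sum_v (d u v - (e u v)%:R) * (d v u - (e u v)%:R) =
  k%:R ^+ 2 + k%:R + \sum_u \sum_v (e u v)%:R - 2 * \tr Lam.
Proof.
rewrite -sum_coldrop_mul mulr2n mulrDl mul1r -{1}sum_edge_coldrop.
have <- : \sum_u \sum_v (e u v)%:R * d v u = \tr Lam.
  rewrite -sum_edge_coldrop exchange_big /=; apply: eq_bigr => u _.
  by apply: eq_bigr => v _; rewrite e_sym.
rewrite -!big_split -sumrB; apply: eq_bigr => u _ /=.
rewrite -!big_split -sumrB; apply: eq_bigr => v _ /=.
by case: (e u v); rewrite /=; ring.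
Qed.

Hypothesis d_itv : forall u v, 0 <= d u v <= 1.

(** Both factors are nonpositive at an edge and nonnegative elsewhere. *)
Lemma gap_term_ge0 u v : 0 <= (d u v - (e u v)%:R) * (d v u - (e u v)%:R).
Proof.
have /andP[? ?] := d_itv u v; have /andP[? ?] := d_itv v u.
by case: (e u v); [rewrite mulr_le0 // subr_le0 | rewrite !subr0 mulr_ge0].
Qed.

Lemma frame_trace_le :
  2 * \tr Lam <= k%:R ^+ 2 + k%:R + \sum_u \sum_v (e u v)%:R.
Proof.
rewrite -subr_ge0 -gap_identity; apply: sumr_ge0 => u _.
by apply: sumr_ge0 => v _; exact: gap_term_ge0.
Qed.

Lemma frame_trace_eq :
  2 * \tr Lam = k%:R ^+ 2 + k%:R + \sum_u \sum_v (e u v)%:R ->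
  forall u v, (d u v - (e u v)%:R) * (d v u - (e u v)%:R) = 0.
Proof.
move=> eq u v; have := gap_identity; rewrite eq subrr => /eqP.
rewrite psumr_eq0; last by move=> x _; apply: sumr_ge0 => y _; exact: gap_term_ge0.
move=> /allP/(_ u (mem_index_enum u)) /=.
rewrite psumr_eq0; last by move=> x _; exact: gap_term_ge0.
by move=> /allP/(_ v (mem_index_enum v)) /= /eqP.
Qed.

Section Structure.
Hypothesis gap0 : forall u v, (d u v - (e u v)%:R) * (d v u - (e u v)%:R) = 0.
Variable X : {set 'I_n}.
Hypothesis dX : forall a w, a \in X -> w != a -> d a w = 1.
Hypothesis Xcover : forall u v, u \notin X -> v \notin X -> ~~ e u v.

Lemma fullset_clique a b : a \in X -> b \in X -> a != b -> e a b.
Proof.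
move=> aX bX ab; have := gap0 a b; case: (e a b) => //.
rewrite (dX aX) 1?eq_sym // (dX bX) // subr0 mulr1 => /eqP.
by rewrite oner_eq0.
Qed.

Lemma coldrop_nonedge a b : a \in X -> b \notin X -> ~~ e a b -> d b a = 0.
Proof.
move=> aX bX /negbTE ab; have := gap0 a b; rewrite ab !subr0.
by rewrite (dX aX) ?mul1r //; apply: contraNneq bX => ->.
Qed.

Lemma coldrop_indep b b' : b \notin X -> b' \notin X -> d b b' * d b' b = 0.
Proof.
by move=> bX b'X; have := gap0 b b'; rewrite (negbTE (Xcover bX b'X)) !subr0.
Qed.

(** The whole column sums to [k], and each [u] of [X] other than [a] contributes
    1 to it. *)
Lemma sum_coldrop_full a : a \in X ->
  \sum_(b | b \notin X) d b a = k%:R - #|X|%:R + 1.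
Proof.
move=> aX; rewrite -(sum_coldrop a) [in RHS](bigID (fun i => i \in X)) /= addrAC.
suff -> : \sum_(i in X) d i a = #|X|%:R - 1 by ring.
rewrite (bigD1 a) //= coldrop_diag add0r (eq_bigr (fun=> 1)); last first.
  by move=> i /andP[iX ia]; rewrite dX // eq_sym.
have -> : #|X|%:R = 1 + \sum_(i in X | i != a) 1 :> R.
  by rewrite -sum1_card natr_sum (bigD1 a).
by rewrite addrC addKr.
Qed.

Lemma sum_coldrop_outside b : b \notin X ->
  \sum_(c | c \notin X) d c b = k%:R - #|X|%:R.
Proof.
move=> bX; rewrite -(sum_coldrop b) [in RHS](bigID (fun i => i \in X)) /=.
rewrite (eq_bigr (P := fun i => i \in X) (fun=> 1)); last first.
  by move=> i iX; rewrite dX //; apply: contraNneq bX => ->.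
by rewrite sumr_const addrAC subrr add0r.
Qed.

(** With [s = #|X|], the sum of the products [d u v * d v u] is
    [s k + s (k - s + 1)]; equating it to [k^2 + k] gives
    [(k - s) (k - s + 1) = 0]. *)
Lemma fullset_card : k%:R = #|X|%:R :> R \/ k%:R + 1 = #|X|%:R :> R.
Proof.
have : (k%:R - #|X|%:R) * (k%:R - #|X|%:R + 1) = 0 :> R.
  have := sum_coldrop_mul; rewrite (bigID (fun i => i \in X)) /=.
  have -> : \sum_(u in X) \sum_v d u v * d v u = #|X|%:R * k%:R.
    rewrite mulr_natl -sumr_const; apply: eq_bigr => u uX.
    rewrite -(sum_coldrop u); apply: eq_bigr => v _.
    by case: (eqVneq v u) => [->|vu]; rewrite ?coldrop_diag ?mulr0 // dX // mul1r.
  have -> : \sum_(u | u \notin X) \sum_v d u v * d v u =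
            #|X|%:R * (k%:R - #|X|%:R + 1).
    rewrite exchange_big (bigID (fun i => i \in X)) /=.
    rewrite [X in _ + X]big1 ?addr0; last first.
      by move=> v vX; rewrite big1 // => u uX; exact: coldrop_indep.
    rewrite mulr_natl -sumr_const; apply: eq_bigr => v vX.
    rewrite -(sum_coldrop_full vX); apply: eq_bigr => u uX.
    by rewrite [d v u]dX ?mulr1 //; apply: contraNneq uX => ->.
  move=> H; apply/eqP; rewrite -subr_eq0; apply/eqP.
  by move/eqP: H; rewrite -subr_eq0 => /eqP H; lra.
move/eqP; rewrite mulf_eq0 => /orP[/eqP h|/eqP h]; [left|right]; lra.
Qed.

Section Split.
Hypothesis cardX : k%:R = #|X|%:R :> R.

Lemma coldrop_outside b c : b \notin X -> c \notin X -> d c b = 0.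
Proof.
move=> bX cX; have := sum_coldrop_outside bX; rewrite cardX subrr => /eqP.
rewrite psumr_eq0; last by move=> x _; case/andP: (d_itv x b).
by move=> /allP/(_ c (mem_index_enum c)); rewrite cX => /eqP.
Qed.

Lemma sum_coldrop_split a : a \in X -> \sum_(b | b \notin X) d b a = 1.
Proof. by move=> aX; rewrite sum_coldrop_full // cardX subrr add0r. Qed.

(** The equation [Pi L Pi = Pi L], which says that the row space of [Z] is
    invariant, is quadratic in the drops. It is read here on the difference of
    the rows [a] and [b], at column [b], where all terms on the right are
    nonnegative. *)
Lemma riccati a b : a \in X -> b \notin X -> d b a = 0 ->
  - (e a b)%:R = \sum_(v in X | v != a)
     (\sum_(z | z \notin X) d z a * (1 - (e z v)%:R)) * d b v.
Proof.
move=> aX bX dba.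
(* [r] is the difference of the rows [a] and [b] of [Pi], [y] its image. *)
pose r x := d x b - d x a.
pose y x := \sum_z r z * laplacian z x.
have rX z : z \in X -> r z = (a == z)%:R.
  move=> zX; rewrite /r dX //; last by apply: contraNneq bX => ->.
  case: (eqVneq a z) => [<-|az]; first by rewrite coldrop_diag subr0.
  by rewrite dX // subrr.
have rB z : z \notin X -> r z = - d z a.
  by move=> zX; rewrite /r coldrop_outside // sub0r.
have yE x : y x = r x * (\sum_z (e x z)%:R) - \sum_z r z * (e z x)%:R.
  rewrite /y; under eq_bigr do rewrite mxE mulrBr mulrCA.
  rewrite sumrB; congr (_ - _); under eq_bigr do rewrite eq_sym.
  by rewrite (sum_pick (fun z => r z * _)).
have y0 : \sum_x y x = 0.
  rewrite /y exchange_big big1 // => z _ /=.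
  by rewrite -mulr_sumr laplacian_sum0 mulr0.
have yPi x : \sum_v y v * Pi v x = y x.
  pose rr := row a Pi - row b Pi.
  have rE z : rr 0 z = r z.
    have rowE0 c : row c Pi 0 z = Pi c z by rewrite mxE.
    rewrite (_ : rr 0 z = row a Pi 0 z - row b Pi 0 z); last first.
      by rewrite /rr [LHS]mxE; congr (_ + _); rewrite mxE.
    by rewrite !rowE0 /r /coldrop; ring.
  have yy z : (rr *m laplacian) 0 z = y z.
    by rewrite mxE; apply: eq_bigr => v _; rewrite rE.
  transitivity ((rr *m laplacian *m Pi) 0 x).
    by rewrite [RHS]mxE; apply: eq_bigr => v _; rewrite yy.
  rewrite -yy; congr (_ 0 x).
  have inv : Pi *m (laplacian *m Pi) = Pi *m laplacian.
    rewrite /Pi -!mulmxA ZL (mulmxA laplacian) (mulmxA Z) (mulmxA Z) ZL -(mulmxA Lam).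
    by rewrite ZC mulmx1.
  pose D : 'rV[R]_n := delta_mx 0 a - delta_mx 0 b.
  have -> : rr = D *m Pi by rewrite mulmxBl -!rowE.
  by rewrite -(mulmxA D Pi laplacian) -(mulmxA D) -(mulmxA Pi laplacian Pi) inv.
have yb : y b = - (e a b)%:R.
  rewrite yE rB // dba oppr0 mul0r sub0r (bigID (fun i => i \in X)) /=.
  rewrite [X in _ + X]big1 ?addr0; last first.
    by move=> z zX; rewrite (negbTE (Xcover zX bX)) mulr0.
  congr (- _); rewrite (bigD1 a) //= rX // eqxx mul1r big1 ?addr0 // => z.
  by case/andP=> zX za; rewrite rX // eq_sym (negbTE za) mul0r.
have yX v : v \in X -> v != a ->
    y v = - \sum_(z | z \notin X) d z a * (1 - (e z v)%:R).
  move=> vX va; rewrite yE rX // eq_sym (negbTE va) mul0r sub0r; congr (- _).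
  under [RHS]eq_bigr do rewrite mulrBr mulr1.
  rewrite sumrB sum_coldrop_split // (bigID (fun i => i \in X)) /=; congr (_ + _).
    rewrite (bigD1 a) //= rX // eqxx mul1r big1 => [|z].
      by rewrite addr0 fullset_clique // eq_sym.
    by case/andP=> zX za; rewrite rX // eq_sym (negbTE za) mul0r.
  by rewrite -sumrN; apply: eq_bigr => z zX; rewrite rB // mulNr.
rewrite -yb -yPi.
have -> : \sum_v y v * Pi v b = - \sum_v y v * d b v.
  transitivity (\sum_v (y v * Pi b b - y v * d b v)).
    by apply: eq_bigr => v _; rewrite /coldrop; ring.
  by rewrite sumrB -mulr_suml y0 mul0r sub0r.
rewrite (bigID (fun i => i \in X)) /= [X in _ + X]big1 ?addr0; last first.
  by move=> v vX; rewrite coldrop_outside // mulr0.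
rewrite (bigD1 a) //= dba mulr0 add0r -sumrN; apply: eq_bigr => v /andP[vX va].
by rewrite yX // mulNr opprK.
Qed.

Lemma riccati_term_ge0 a b v : 
  0 <= (\sum_(z | z \notin X) d z a * (1 - (e z v)%:R)) * d b v.
Proof.
have d0 x y : 0 <= d x y by case/andP: (d_itv x y).
apply: mulr_ge0 => //; apply: sumr_ge0 => z _; apply: mulr_ge0 => //.
by rewrite subr_ge0; case: (e z v); rewrite ?ler01.
Qed.

(** Otherwise [riccati] equates -1 to a sum of nonnegative terms. *)
Lemma edge_coldrop_neq0 a b : a \in X -> b \notin X -> e a b -> d b a != 0.
Proof.
move=> aX bX ab; apply/eqP => /(riccati aX bX); rewrite ab => /eqP.
rewrite lt_eqF //; apply: (@lt_le_trans _ _ 0); first by rewrite ltrN10.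
by apply: sumr_ge0 => v _; exact: riccati_term_ge0.
Qed.

(** Since [a] and [b] are not adjacent, [riccati] is a vanishing sum of nonnegative
    terms. In the one of [v = a'] and [z = b'] the two drops are nonzero, so the
    factor [1 - (e b' a')%:R] vanishes. *)
Lemma split_nested a a' b b' : a \in X -> a' \in X -> b \notin X -> b' \notin X ->
  ~~ e a b -> e a' b -> e a b' -> e a' b'.
Proof.
move=> aX a'X bX b'X ab a'b ab'.
have dba := coldrop_nonedge aX bX ab.
have a'a : a' != a by apply: contraNneq ab => <-.
have := riccati aX bX dba; rewrite (negbTE ab) oppr0 => /esym/eqP.
rewrite psumr_eq0; last by move=> v _; exact: riccati_term_ge0.
move=> /allP/(_ a' (mem_index_enum a')); rewrite a'X a'a /=.
rewrite mulf_eq0 (negbTE (edge_coldrop_neq0 a'X bX a'b)) orbF.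
rewrite psumr_eq0; last first.
  move=> z _; apply: mulr_ge0; first by case/andP: (d_itv z a).
  by rewrite subr_ge0; case: (e z a'); rewrite ?ler01.
move=> /allP/(_ b' (mem_index_enum b')); rewrite b'X /=.
rewrite mulf_eq0 (negbTE (edge_coldrop_neq0 aX b'X ab')) /= e_sym.
by case: (e a' b') => //; rewrite subr0 oner_eq0.
Qed.

Lemma split_neighbor a : a \in X -> exists2 b, b \notin X & e a b.
Proof.
move=> aX; case: (pickP [pred b | (b \notin X) && e a b]) => [b /andP[] |no].
  by exists b.
have := sum_coldrop_split aX; rewrite big1 => [/esym/eqP|b bX].
  by rewrite oner_eq0.
by apply: coldrop_nonedge => //; have := no b; rewrite /= bX /= => ->.
Qed.

End Split.
End Structure.
End Frame.
End Gap.

(** * Diagonalization of symmetric matrices *)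

Section Diagonalisation.
Variable R : realType.

(** The diagonal entries of [S *m S] are sums of squares of the entries of
    [S]. *)
Lemma sym_sqr0 n (S : 'M[R]_n) : S^T = S -> S *m S = 0 -> S = 0.
Proof.
move=> S_sym S2; apply/matrixP => i j; rewrite mxE; apply/eqP.
have : (S *m S) i i = 0 by rewrite S2 mxE.
rewrite mxE => /eqP; rewrite psumr_eq0 => [/allP/(_ j (mem_index_enum j))|x _].
  by rewrite -{2}S_sym mxE -expr2 sqrf_eq0.
by rewrite -{2}S_sym mxE -expr2 sqr_ge0.
Qed.

Lemma sym_nilpotent n (S : 'M[R]_n.+1) m : S^T = S -> S ^+ m = 0 -> S = 0.
Proof.
move=> S_sym Sm.
have trX p : (S ^+ p)^T = S ^+ p.
  elim: p => [|p IH]; first by rewrite !expr0 trmx1.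
  by rewrite exprS trmx_mul IH S_sym -[RHS]exprS exprSr.
suff H j : S ^+ (2 ^ j) = 0 -> S = 0.
  apply: (H m); have : (m <= 2 ^ m)%N by apply: ltnW; exact: ltn_expl.
  by move=> /subnK <-; rewrite exprD Sm mulr0.
elim: j => [|j IH]; first by rewrite expn0 expr1.
rewrite expnS mulnC exprM expr2 => S2; apply: IH; exact: sym_sqr0.
Qed.

Lemma char_poly_simmx n (P A B : 'M[R]_n) : P \in unitmx -> P *m A = B *m P ->
  char_poly A = char_poly B.
Proof.
move=> Pu PA; rewrite /char_poly.
pose PX := map_mx polyC P.
have e : PX *m char_poly_mx A = char_poly_mx B *m PX.
  rewrite /char_poly_mx mulmxBr mulmxBl -!map_mxM PA; congr (_ - _).
  by rewrite scalar_mxC.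
have dP : \det PX != 0.
  by rewrite det_map_mx polyC_eq0 -unitfE -unitmxE.
by apply: (mulfI dP); rewrite -det_mulmx e det_mulmx mulrC.
Qed.

Lemma horner_mx_sym n (L : 'M[R]_n.+1) p :
  L^T = L -> (horner_mx L p)^T = horner_mx L p.
Proof.
move=> L_sym; elim/poly_ind: p => [|p c IH]; first by rewrite rmorph0 trmx0.
rewrite rmorphD rmorphM /= horner_mx_X horner_mx_C linearD /= tr_scalar_mx.
by rewrite trmx_mul IH L_sym; congr (_ + _); exact: comm_mx_horner.
Qed.

(** The product of the distinct factors ['X - a%:P] has a power divisible by the
    characteristic polynomial. Its value at [L] is therefore nilpotent, and 0
    by symmetry, which bounds the minimal polynomial by one with simple
    roots. *)
Lemma sym_diagonalizable n (L : 'M[R]_n) (mu : seq R) : L^T = L ->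
  char_poly L = \prod_(a <- mu) ('X - a%:P) -> diagonalizable L.
Proof.
case: n L => [|n] L L_sym Lmu; first by rewrite (flatmx0 L); exact: diagonalizable0.
pose p := \prod_(a <- undup mu) ('X - a%:P).
apply/diagonalizableP; exists (undup mu); first exact: undup_uniq.
apply: mxminpoly_min; apply: (@sym_nilpotent _ _ (size mu)).
  exact: horner_mx_sym.
have /dvdpP[q pq] : char_poly L %| p ^+ size mu.
  rewrite Lmu; have : all (mem (undup mu)) mu.
    by apply/allP => x; rewrite /= mem_undup.
  elim: {2 3 4}mu => [|a s IH] /=; first by rewrite big_nil expr0 dvdpp.
  move=> /andP[ap sp]; rewrite big_cons exprS dvdp_mul //; last exact: IH.
  by rewrite dvdp_XsubCl root_prod_XsubC.
by rewrite -rmorphXn /= pq rmorphM /= Cayley_Hamilton mulr0.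
Qed.

Lemma sym_diag n (L : 'M[R]_n) (mu : n.-tuple R) : L^T = L ->
  char_poly L = \prod_(a <- mu) ('X - a%:P) ->
  exists2 Q, Q \in unitmx & Q *m L = diag_mx (\row_i mu`_i) *m Q.
Proof.
move=> L_sym Lmu.
have [P Pu /diagonalizable_forPex[D /(mxpoly.simmxP Pu) PL]] :=
  sym_diagonalizable L_sym Lmu.
have : perm_eq mu [tuple D 0 i | i < n].
  apply: prod_XsubC_eq; rewrite -Lmu (char_poly_simmx Pu PL).
  rewrite char_poly_trig; last by apply/diag_mx_is_trig.
  rewrite big_map big_enum; apply: eq_bigr => i _.
  by rewrite !mxE eqxx mulr1n.
move=> /tuple_permP[s es].
exists (row_perm s P).
  by rewrite row_permE unitmx_mul Pu unitmx_perm.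
have muD (i : 'I_n) : mu`_i = D 0 (s i).
  by rewrite es -tnth_nth !tnth_mktuple.
have -> : row_perm s P *m L = row_perm s (diag_mx D *m P).
  by rewrite !row_permE -mulmxA PL.
by apply/matrixP => i j; rewrite !mul_diag_mx !mxE muD.
Qed.

(** In coordinates given by the rows of [Q], the matrix [Z] becomes [B] with
    [B *m diag_mx d = Lam *m B]. Selecting [k] independent columns of [B] gives an
    invertible matrix that conjugates [Lam] to the diagonal matrix of the selected
    eigenvalues. *)
Lemma invariant_trace n k (L Q : 'M[R]_n) (d : 'rV[R]_n)
    (Z : 'M[R]_(k, n)) (Lam : 'M[R]_k) :
  Q \in unitmx -> Q *m L = diag_mx d *m Q -> row_free Z -> Z *m L = Lam *m Z ->
  exists2 h : 'I_k -> 'I_n, injective h & \tr Lam = \sum_i d 0 (h i).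
Proof.
move=> Qu QL Zfree ZL.
pose B := Z *m invmx Q.
have ZE : Z = B *m Q by rewrite mulmxKV.
have BD : B *m diag_mx d = Lam *m B.
  apply: (can_inj (mulmxK Qu)).
  by rewrite -[LHS]mulmxA -QL mulmxA -ZE ZL -mulmxA -ZE.
have Bfree : row_full B^T.
  rewrite /row_full mxrank_tr mxrankMfree //.
  by rewrite row_free_unit unitmx_inv.
pose h := fullrankfun Bfree; exists h; first exact: fullrankfun_inj.
pose M := colsub h B.
have Mu : M \in unitmx.
  by rewrite -unitmx_tr /M trmx_mxsub; exact: fullrowsub_unit.
have MD : Lam *m M = M *m diag_mx (\row_i d 0 (h i)).
  apply/matrixP => i j.
  have -> : (Lam *m M) i j = (Lam *m B) i (h j).
    by rewrite !mxE; apply: eq_bigr => x _; rewrite mxE.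
  by rewrite -BD !mul_mx_diag !mxE.
have -> : Lam = M *m diag_mx (\row_i d 0 (h i)) *m invmx M.
  by rewrite -MD mulmxK.
rewrite mxtrace_mulC mulmxA mulVmx // mul1mx mxtrace_diag.
by apply: eq_bigr => i _; rewrite mxE.
Qed.

End Diagonalisation.

(** * Invariant spaces of threshold graphs *)

Section Converse.
Variables (R : realType) (n : nat) (e : rel 'I_n).
Hypotheses (e_sym : symmetric e) (e_irr : irreflexive e).

Definition induced (S : {set 'I_n}) : rel 'I_n :=
  fun u v => [&& u \in S, v \in S & e u v].

Lemma laplacian_sym (f : rel 'I_n) : symmetric f ->
  (laplacian R f)^T = laplacian R f.
Proof.
move=> f_sym; apply/matrixP => i j; rewrite !mxE eq_sym f_sym.
by case: eqP => [->|]; rewrite ?mul0r.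
Qed.

Lemma induced_sym S : symmetric (induced S).
Proof. by move=> u v; rewrite /induced e_sym andbCA. Qed.

(** An invariant space of dimension [j] on which the Laplacian of the graph
    induced on [S] has trace equal to the number of edges plus [j (j + 1) / 2]; the
    double sum counts each edge twice. *)
Definition eigenframe S j (Z : 'M[R]_(j, n)) (Lam : 'M[R]_j) :=
  [/\ row_free Z, Z *m laplacian R (induced S) = Lam *m Z,
      forall i, \sum_v Z i v = 0, forall i v, v \notin S -> Z i v = 0 &
      2 * \tr Lam = j%:R ^+ 2 + j%:R + \sum_u \sum_v (induced S u v)%:R].

Section Dominating.
Variables (S : {set 'I_n}) (x : 'I_n).
Hypotheses (xS : x \notin S) (dom : forall y, y \in S -> e x y).

Let star u v : bool := ((u == x) && (v \in S)) || ((v == x) && (u \in S)).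

Lemma induced_dom u v :
  (induced (x |: S) u v)%:R = (induced S u v)%:R + (star u v)%:R :> R.
Proof.
rewrite /induced /star !in_setU1.
case: (eqVneq u x) => [->|ux]; case: (eqVneq v x) => [->|vx];
  rewrite /= ?e_irr ?(negbTE xS) ?add0r ?andbF ?orbF //=.
- by case: (boolP (v \in S)) => // vS; rewrite dom.
- by rewrite add0r; case: (boolP (u \in S)) => //= uS; rewrite e_sym dom.
- by rewrite addr0.
Qed.

Lemma star_sum y : \sum_u (star y u)%:R =
  (y == x)%:R * #|S|%:R + (y \in S)%:R :> R.
Proof.
rewrite /star; case: (eqVneq y x) => [->|yx] /=.
  rewrite (negbTE xS) addr0 mul1r -sumr_const [in RHS]big_mkcond.
  by apply: eq_bigr => u _; rewrite andbF orbF; case: (u \in S).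
rewrite mul0r add0r (bigD1 x) //= eqxx /= big1 ?addr0 // => u /negbTE ->.
by [].
Qed.

Lemma laplacian_dom (z : 'rV[R]_n) y :
  (z *m laplacian R (induced (x |: S))) 0 y =
  (z *m laplacian R (induced S)) 0 y +
  (z 0 y * ((y == x)%:R * #|S|%:R + (y \in S)%:R) -
   ((y \in S)%:R * z 0 x + (y == x)%:R * \sum_(u in S) z 0 u)).
Proof.
rewrite !mxE.
have -> : (y \in S)%:R * z 0 x + (y == x)%:R * \sum_(u in S) z 0 u =
          \sum_u z 0 u * (star u y)%:R.
  rewrite [RHS](bigD1 x) //= {1}/star eqxx /= (negbTE xS) andbF orbF mulrC.
  congr (_ + _); rewrite [in LHS]big_mkcond (bigD1 x) //= (negbTE xS) add0r.
  rewrite big_distrr; apply: eq_bigr => u /negbTE ux /=.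
  rewrite /star ux /=; case: (y == x); case: (u \in S);
  by rewrite ?mul1r ?mul0r ?mulr1 ?mulr0.
rewrite -star_sum.
have -> : z 0 y * \sum_u (star y u)%:R =
          \sum_u z 0 u * ((u == y)%:R * \sum_v (star u v)%:R).
  rewrite -(sum_pick (fun u => z 0 u * \sum_v (star u v)%:R) y).
  by apply: eq_bigr => u _; rewrite eq_sym mulrCA.
rewrite -sumrB -big_split; apply: eq_bigr => u _ /=; rewrite !mxE.
have -> : \sum_v (induced (x |: S) u v)%:R =
    \sum_v (induced S u v)%:R + \sum_v (star u v)%:R :> R.
  by rewrite -big_split; apply: eq_bigr => v _; exact: induced_dom.
by rewrite induced_dom; ring.
Qed.

(** The row [r] is an eigenvector of eigenvalue [#|S| + 1], and on vectors
    supported in [S] and summing to 0 the Laplacian grows by the identity. The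
    trace thus grows by [#|S| + 1 + j], the number of new edges plus [j + 1]. *)
Lemma eigenframe_dom j (Z : 'M[R]_(j, n)) (Lam : 'M[R]_j) :
  S != set0 -> eigenframe S Z Lam ->
  exists Z' : 'M[R]_(j.+1, n), exists Lam' : 'M[R]_j.+1,
    eigenframe (x |: S) Z' Lam'.
Proof.
move=> S0 [Zfree ZL Z0 ZS trLam].
pose r : 'rV[R]_n := \row_u ((u == x)%:R * #|S|%:R - (u \in S)%:R).
have Sgt0 : (0 < #|S|)%N by rewrite card_gt0.
pose c : R := #|S|%:R.
exists (col_mx r Z : 'M_(1 + j, n)).
exists (block_mx (c + 1)%:M 0 0 (Lam + 1%:M) : 'M_(1 + j)).
have rx : r 0 x = c by rewrite mxE eqxx (negbTE xS) mul1r subr0.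
have rS u : u \in S -> r 0 u = -1.
  move=> uS; rewrite mxE uS; case: eqP => [ux|_]; last by rewrite mul0r sub0r.
  by move: xS; rewrite -ux uS.
have rO u : u != x -> u \notin S -> r 0 u = 0.
  by move=> /negbTE ux /negbTE uS; rewrite mxE ux uS mul0r subr0.
split.
- apply: inj_row_free.
  change (forall w : 'rV[R]_(1 + j), w *m col_mx r Z = 0 -> w = 0) => w.
  rewrite -[w]hsubmxK mul_row_col => w0.
  have a0 : lsubmx w = 0.
    apply/matrixP => a b; rewrite !ord1.
    have := congr1 (fun M : 'M_(1, n) => M 0 x) w0.
    rewrite mxE [in X in _ + X]mxE big1 => [|i _]; last by rewrite ZS ?mulr0.
    rewrite addr0 mxE big_ord1 rx [RHS]mxE => /eqP.
    by rewrite mulf_eq0 pnatr_eq0 (gtn_eqF Sgt0) orbF [in RHS]mxE => /eqP.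
  move: w0; rewrite a0 mul0mx add0r => /eqP.
  by rewrite mulmx_free_eq0 // => /eqP ->; rewrite row_mx0.
- change (col_mx r Z *m laplacian R (induced (x |: S)) =
          block_mx (c + 1)%:M 0 0 (Lam + 1%:M) *m col_mx r Z).
  rewrite mul_col_mx mul_block_col !mul0mx addr0 add0r mulmxDl mul1mx -ZL.
  congr col_mx.
    apply/rowP => y; rewrite laplacian_dom mul_scalar_mx [RHS]mxE.
    have -> : (r *m laplacian R (induced S)) 0 y = 0.
      rewrite mxE (bigID (fun u => u \in S)) /= [X in _ + X]big1 ?addr0.
        rewrite -[RHS]oppr0 -[in RHS](laplacian_sum0 R (induced S) y) -sumrN.
        rewrite [in RHS](bigID (fun u => u \in S)) /= [X in _ = _ + X]big1 ?addr0.
          apply: eq_bigr => u uS; rewrite rS // mulN1r.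
          by rewrite -[in LHS](laplacian_sym (induced_sym S)) mxE.
        move=> u uS; rewrite !mxE /induced (negbTE uS) andbF subr0.
        case: eqP => [yu|_]; last by rewrite mul0r oppr0.
        by rewrite big1 ?mulr0 ?oppr0 // => v _; rewrite yu (negbTE uS).
      move=> u uS; rewrite [laplacian _ _ _ _]mxE /induced (negbTE uS) /= subr0.
      by rewrite big1 ?mulr0.
    have -> : \sum_(u in S) r 0 u = - c.
      by rewrite (eq_bigr (fun=> -1)) // sumr_const mulNrn.
    rewrite add0r rx; case: (eqVneq y x) => [->|yx].
      by rewrite rx (negbTE xS) /c /=; ring.
    case: (boolP (y \in S)) => yS; first by rewrite rS // /c /=; ring.
    by rewrite rO // /=; ring.
  apply/row_matrixP => i; rewrite linearD /= !row_mul; apply/rowP => y.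
  rewrite laplacian_dom [RHS]mxE; congr (_ + _).
  have -> : row i Z 0 x = 0 by rewrite mxE ZS.
  have -> : \sum_(u in S) row i Z 0 u = 0.
    rewrite -[RHS](Z0 i) [in RHS](bigID (fun u => u \in S)) /=.
    rewrite [X in _ = _ + X]big1 ?addr0 => [|u uS]; last by rewrite ZS.
    by apply: eq_bigr => u _; rewrite mxE.
  rewrite !mulr0 addr0 subr0; case: (eqVneq y x) => [->|yx].
    by rewrite mxE ZS // mul0r.
  case: (boolP (y \in S)) => yS; first by rewrite mul0r add0r mulr1.
  by rewrite mxE ZS // mul0r.
- change (forall i : 'I_(1 + j), \sum_v col_mx r Z i v = 0) => i.
  case: (split_ordP i) => a ->.
    have -> : \sum_v col_mx r Z (lshift j a) v = \sum_v r 0 v.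
      by apply: eq_bigr => v _; rewrite col_mxEu (ord1 a).
    under eq_bigr do rewrite mxE.
    rewrite sumrB; under eq_bigr do rewrite eq_sym.
    rewrite (sum_pick (fun=> _)) -sumr_const big_mkcond /= -sumrB big1 // => u _.
    by case: (u \in S); rewrite subrr.
  by under eq_bigr do rewrite col_mxEd.
- change (forall (i : 'I_(1 + j)) v, v \notin x |: S -> col_mx r Z i v = 0) => i v.
  rewrite in_setU1 negb_or => /andP[vx vS].
  case: (split_ordP i) => a ->; first by rewrite col_mxEu ord1 rO.
  by rewrite col_mxEd ZS.
- have trE : \tr (block_mx (c + 1)%:M 0 0 (Lam + 1%:M) : 'M_(1 + j)) =
      c + 1 + (\tr Lam + j%:R).
    by rewrite mxtrace_block mxtrace_scalar mxtraceD mxtrace1.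
  rewrite trE.
  have -> : \sum_u \sum_v (induced (x |: S) u v)%:R =
            \sum_u \sum_v (induced S u v)%:R + 2 * c.
    under eq_bigr => u _ do under eq_bigr => v _ do rewrite induced_dom.
    under eq_bigr do rewrite big_split /= star_sum.
    rewrite big_split /=; congr (_ + _); rewrite big_split /=.
    under eq_bigr do rewrite eq_sym.
    rewrite (sum_pick (fun=> _)) mulr2n mulrDl mul1r; congr (_ + _).
    rewrite /c -sumr_const [RHS]big_mkcond /=; apply: eq_bigr => u _.
    by case: (u \in S).
  by move: trLam; rewrite -[j.+1]addn1 natrD; lra.
Qed.

End Dominating.

(** Isolated vertices leave the frame and the largest clique unchanged, and each
    dominating vertex extends both by one. *)
Lemma threshold_eigenframe S : threshold_on e S ->
  S != set0 /\ exists j, [/\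
    exists Z : 'M[R]_(j, n), exists Lam, eigenframe S Z Lam,
    exists K : {set 'I_n}, [/\ K \subset S, clique e K & #|K| = j.+1] &
    forall K : {set 'I_n}, K \subset S -> clique e K -> (#|K| <= j.+1)%N].
Proof.
elim=> [x|{}S x _ [S0 [j [[Z [Lam [Zf ZL Z0 ZS tr]]] [K [KS cK sK]] maxK]]] xS iso|
        {}S x _ [S0 [j [[Z [Lam ZE]] [K [KS cK sK]] maxK]]] xS dom].
- split; first by apply/set0Pn; exists x; rewrite inE.
  exists 0%N; split.
  + exists 0, 0; split=> //.
    * by rewrite /row_free mxrank0.
    * by rewrite mul0mx mulmx0.
    * by case.
    * by case.
    rewrite mxtrace0 mulr0 expr0n /= !add0r big1 // => u _; rewrite big1 // => v _.
    rewrite /induced !inE; case: eqP => [->|] //=.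
    by case: eqP => [->|] //=; rewrite e_irr.
  + exists [set x]; split; rewrite ?cards1 //.
    apply/forall_inP => u /set1P ->; apply/forall_inP => v /set1P ->.
    by rewrite eqxx.
  + by move=> K /subset_leq_card; rewrite cards1.
- split; first by apply/set0Pn; exists x; rewrite setU11.
  have iE u v : induced (x |: S) u v = induced S u v.
    rewrite /induced !in_setU1; case: (eqVneq u x) => [->|ux];
      case: (eqVneq v x) => [->|vx] //=; rewrite ?e_irr ?(negbTE xS) ?andbF //=.
    + by case: (boolP (v \in S)) => //= vS; apply/negbTE/iso.
    + by case: (boolP (u \in S)) => //= uS; rewrite e_sym; apply/negbTE/iso.
  have lE : laplacian R (induced (x |: S)) = laplacian R (induced S).
    apply/matrixP => u v; rewrite !mxE iE; congr (_ * _ - _).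
    by apply: eq_bigr => w _; rewrite iE.
  exists j; split.
  + exists Z, Lam; split; rewrite ?lE //.
      by move=> i v; rewrite in_setU1 negb_or => /andP[_]; exact: ZS.
    rewrite tr; congr (_ + _); apply: eq_bigr => u _.
    by apply: eq_bigr => v _; rewrite iE.
  + by exists K; split=> //; apply: subset_trans KS (subsetUr _ _).
  + move=> K' K'S cK'; case: (boolP (x \in K')) => xK'.
      have -> : K' = [set x].
        apply/eqP; rewrite eqEsubset sub1set xK' andbT; apply/subsetP => y yK'.
        rewrite inE; apply/negPn/negP => yx.
        have := subsetP K'S y yK'; rewrite in_setU1 (negbTE yx) /= => yS.
        have := iso y yS; have /forall_inP/(_ x xK')/forall_inP/(_ y yK') := cK'.
        by rewrite eq_sym yx /= => ->.
      by rewrite cards1.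
    apply: maxK => //; apply/subsetP => y yK'.
    have := subsetP K'S y yK'; rewrite in_setU1; case: eqP => // yx.
    by rewrite yx (negbTE xK') in yK'.
- split; first by apply/set0Pn; exists x; rewrite setU11.
  exists j.+1; split.
  + exact: eigenframe_dom ZE.
  + exists (x |: K); split.
    * exact: setUS.
    * apply/forall_inP => u; rewrite in_setU1 => uK; apply/forall_inP => v.
      rewrite in_setU1 => vK; apply/implyP => uv.
      case/orP: uK uv => [/eqP ->|uK]; case/orP: vK => [/eqP ->|vK].
      - by rewrite eqxx.
      - by move=> _; apply: dom; apply: (subsetP KS).
      - by move=> _; rewrite e_sym; apply: dom; apply: (subsetP KS).
      - by move: cK => /forall_inP/(_ u uK)/forall_inP/(_ v vK)/implyP.
    * by rewrite cardsU1 sK (contra (subsetP KS x)).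
  + move=> K' K'S cK'.
    have : (#|K' :\ x| <= j.+1)%N.
      apply: maxK.
        by rewrite subDset.
      apply/forall_inP => u /setD1P[_ uK]; apply/forall_inP => v /setD1P[_ vK].
      by move: cK' => /forall_inP/(_ u uK)/forall_inP/(_ v vK).
    rewrite (cardsD1 x K'); case: (x \in K') => //=.
    by rewrite add0n => /leqW.
Qed.

End Converse.

(** * Nested split graphs and the trace bound *)

Section Split.
Variables (V : finType) (e : rel V).
Hypotheses (e_sym : symmetric e) (e_irr : irreflexive e).

(** The last condition forbids alternating 4-cycles: it says that the
    neighbourhoods outside [X] of the members of [X] form a chain. *)
Definition nested_split (X : {set V}) := [/\
  forall a b, a \in X -> b \in X -> a != b -> e a b,
  forall u v, u \notin X -> v \notin X -> ~~ e u v &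
  forall a a' b b', a \in X -> a' \in X -> b \notin X -> b' \notin X ->
    ~~ e a b -> e a' b -> e a b' -> e a' b'].

(** Let [a] in [S] and [X] have as many neighbours in [S] outside [X] as possible.
    If some [b] of [S] outside [X] is not adjacent to [a], then by nestedness it is
    adjacent to no vertex of [S]; if there is none, [a] dominates [S]. When [S] does
    not meet [X], all of its vertices are isolated. In each case one vertex can
    be removed. *)
Lemma threshold_nested_split X S : nested_split X -> S != set0 ->
  threshold_on e S.
Proof.
move=> [Xcl Xind Xnest].
have [m] := ubnP #|S|; elim: m S => // m IH S Sm S0.
have grow x : x \in S -> (forall y, y \in S -> y != x -> ~~ e x y) \/
    (forall y, y \in S -> y != x -> e x y) -> threshold_on e S.
  move=> xS; rewrite -(setD1K xS).
  have [->|S'0] := eqVneq (S :\ x) set0; first by rewrite setU0 => _; constructor.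
  have IHx : threshold_on e (S :\ x).
    by apply: IH => //; rewrite (leq_trans (proper_card (properD1 xS))).
  case=> h; [apply: threshold_isolated|apply: threshold_dominating] => //;
    rewrite ?setD11 // => y yS; apply: h; move: yS; rewrite !inE.
  - by case/andP=> -> ->; rewrite orbT.
  - by case/andP.
  - by case/andP=> -> ->; rewrite orbT.
  - by case/andP.
case: (pickP [pred a in S | a \in X]) => [a0 /= a0SX|noX]; last first.
  have /set0Pn[x xS] := S0; apply: (grow x xS); left=> y yS _.
  have := noX x; have := noX y; rewrite /= xS yS /= => yX xX.
  by rewrite Xind ?xX ?yX.
pose N a := [set b in S | (b \notin X) && e a b].
case: (@arg_maxnP V a0 [pred a in S | a \in X] (fun a => #|N a|) a0SX).
move=> a /andP[/= aS aX] amax.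
case: (pickP [pred b | [&& b \in S, b \notin X & ~~ e a b]]) => [b|dom].
  move=> /and3P[bS bX ab]; apply: (grow b bS); left=> y yS _.
  case: (boolP (y \in X)) => yX; last exact: Xind.
  apply/negP; rewrite e_sym => yb.
  suff : (#|N a| < #|N y|)%N by rewrite ltnNge amax // yS.
  apply/proper_card/properP; split; last first.
    by exists b; rewrite !inE bS bX //= (negbTE ab).
  apply/subsetP => b'; rewrite !inE => /and3P[-> b'X ab'].
  by rewrite b'X (Xnest a y b b').
apply: (grow a aS); right=> y yS ya.
case: (boolP (y \in X)) => yX; first by apply: Xcl => //; rewrite eq_sym.
by have := dom y; rewrite /= yS yX /= => /negbFE.
Qed.

(** A clique has at most one vertex outside [X]. Conversely, an outside neighbour
    of the member of [X] that has the fewest of them is adjacent to all of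
    [X]. *)
Lemma clique_number_nested_split X k : nested_split X -> #|X| = k.+1 ->
  (forall a, a \in X -> exists2 b, b \notin X & e a b) ->
  clique_number e = k.+2.
Proof.
move=> [Xcl Xind Xnest] cX nbr; apply/eqP; rewrite eqn_leq; apply/andP; split.
  apply/bigmax_leqP => K /forall_inP cK.
  rewrite -(cardsID X K) -addn1 -cX leq_add ?subset_leq_card ?subsetIr //.
  apply/card_le1_eqP => x y /setDP[xK xX] /setDP[yK yX]; apply/eqP.
  have /forall_inP/(_ x xK)/implyP := cK y yK.
  by rewrite (negbTE (Xind y x yX xX)) eq_sym; case: eqP => // _ /(_ isT).
have /card_gt0P[a0 a0X] : (0 < #|X|)%N by rewrite cX.
pose N a := [set b | (b \notin X) && e a b].
case: (@arg_minnP V a0 [in X] (fun a => #|N a|) a0X) => a aX amin.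
have [b bX ab] := nbr a aX.
have bdom a' : a' \in X -> e a' b.
  move=> a'X; apply/negPn/negP => a'b.
  suff : (#|N a'| < #|N a|)%N by rewrite ltnNge amin.
  apply/proper_card/properP; split; last by exists b; rewrite !inE bX //= (negbTE a'b).
  apply/subsetP => b'; rewrite !inE => /andP[b'X a'b'].
  by rewrite b'X (Xnest a' a b b').
rewrite -cX -add1n; have <- : #|b |: X| = (1 + #|X|)%N by rewrite cardsU1 bX.
apply: (leq_bigmax_cond (F := fun K : {set V} => #|K|)).
apply/forall_inP => x /setU1P xK; apply/forall_inP => y /setU1P yK.
apply/implyP => xy; case: xK xy => [->|xX]; case: yK => [->|yX].
- by rewrite eqxx.
- by move=> _; rewrite e_sym bdom.
- by move=> _; apply: bdom.
- exact: Xcl.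
Qed.
End Split.

Section Trace.
Variables (R : realType) (n k : nat) (e : rel 'I_n).
Hypotheses (e_sym : symmetric e) (e_irr : irreflexive e).
Variables (Z : 'M[R]_(k, n)) (Lam : 'M[R]_k).
Hypotheses (Zfree : row_free Z) (ZL : Z *m laplacian R e = Lam *m Z).
Hypothesis Z0 : forall i, \sum_v Z i v = 0.

Lemma maximizer_mul_coframe g : maximizer Z g -> Z *m coframe Z g = 1%:M.
Proof. by case=> -[alt_g _] g0 _; apply: mul_coframe => //; rewrite gt_eqF. Qed.

Theorem brouwer_le :
  2 * \tr Lam <= k%:R ^+ 2 + k%:R + \sum_u \sum_v (e u v)%:R.
Proof.
have [g mg] := exists_maximizer Zfree.
apply: (frame_trace_le e_sym ZL Z0 (maximizer_mul_coframe mg)) => u v.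
exact: coldrop_itv.
Qed.

(** By [fullset_card] the points of concentration of the maximizer number [k] or
    [k + 1]. In the latter case they are all the vertices, so that omitting one
    of them keeps their complement independent. *)
Theorem brouwer_eq :
  2 * \tr Lam = k%:R ^+ 2 + k%:R + \sum_u \sum_v (e u v)%:R ->
  exists X, [/\ nested_split e X, #|X| = k &
    forall a, a \in X -> exists2 b, b \notin X & e a b].
Proof.
move=> eqL.
have gap g (mg : maximizer Z g) := frame_trace_eq e_sym ZL Z0
  (maximizer_mul_coframe mg) (fun u v => coldrop_itv u v mg) eqL.
have edge_drop g u v : maximizer Z g -> e u v ->
    coldrop (coframe Z g *m Z) u v = 1 \/ coldrop (coframe Z g *m Z) v u = 1.
  move=> mg uv; have /eqP := gap g mg u v; rewrite uv mulf_eq0 !subr_eq0.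
  by case/orP=> /eqP; [left|right].
have [g [X [mg fX indX]]] := exists_concentrated_cover Zfree e_irr edge_drop.
have ZC := maximizer_mul_coframe mg.
pose d := coldrop (coframe Z g *m Z).
have d_itv u v : 0 <= d u v <= 1 by exact: coldrop_itv.
have dX a w : a \in X -> w != a -> d a w = 1.
  by move=> aX; apply: concentrated_coldrop => //; exact: fX.
have {fX} [Y [dY indY cY]] : exists Y : {set 'I_n}, [/\
    forall a w, a \in Y -> w != a -> d a w = 1,
    forall u v, u \notin Y -> v \notin Y -> ~~ e u v & k%:R = #|Y|%:R :> R].
  have [cX|cX] := fullset_card Z0 ZC (gap g mg) dX indX; first by exists X.
  (* The drops into a vertex outside [X] from outside [X] would sum to -1. *)
  have XT b : b \in X.
    apply/negPn/negP => bX; have := sum_coldrop_outside Z0 ZC dX bX.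
    rewrite -cX opprD addNKr => /eqP; rewrite eq_le => /andP[+ _].
    rewrite leNgt => /negP[]; rewrite (lt_le_trans (ltrN10 R)) //.
    by apply: sumr_ge0 => c _; case/andP: (d_itv c b).
  have /card_gt0P[x xX] : (0 < #|X|)%N.
    by rewrite -(ltr_nat R) -cX ltr_wpDl.
  exists (X :\ x); split.
  - by move=> a w /setD1P[_]; exact: dX.
  - move=> u v; rewrite !inE !XT !andbT !negbK => /eqP -> /eqP ->.
    by rewrite e_irr.
  - by apply/eqP; rewrite -(inj_eq (addIr 1)) cX (cardsD1 x) xX addnC natrD.
exists Y; split.
- split=> //; first exact: (fullset_clique (gap g mg) dY).
  move=> a a' b b'.
  exact: (split_nested e_sym ZL Z0 ZC d_itv (gap g mg) dY indY cY).
- by apply/eqP; rewrite -(eqr_nat R) cY.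
- by move=> a; exact: (split_neighbor Z0 ZC (gap g mg) dY cY).
Qed.
End Trace.

(** After subtraction of the k-th largest value [c], the summands are nonnegative
    at the first [k] positions and nonpositive at the others. *)
Lemma sum_top_le (R : realType) n k (mu : n.-tuple R) (h : 'I_k -> 'I_n) :
  sorted >=%R mu -> injective h -> \sum_i mu`_(h i) <= \sum_(i < k) mu`_i.
Proof.
move=> mu_sorted h_inj.
have kn : (k <= n)%N by have := leq_card h h_inj; rewrite !card_ord.
have mu_le i j : (i <= j < n)%N -> mu`_j <= mu`_i.
  case/andP=> ij jn.
  apply: (sorted_leq_nth (leT := >=%R)) => //.
  - by move=> x y z /= xy yz; apply: le_trans yz xy.
  - by move=> x /=.
  - by rewrite inE size_tuple (leq_ltn_trans ij).
  - by rewrite inE size_tuple.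
case: (posnP k) => [k0|k_gt0].
  by rewrite !big1 // => -[i ik]; have : (i < 0)%N by rewrite -k0.
pose c := mu`_k.-1.
pose top := [set i : 'I_n | (i < k)%N].
have topE (F : nat -> R) : \sum_(i < k) F i = \sum_(i in top) F i.
  rewrite (big_ord_widen n F kn); by apply: eq_bigl => i; rewrite inE.
rewrite (topE (fun i => mu`_i)).
have -> : \sum_i mu`_(h i) = \sum_(i in h @: [set: 'I_k]) mu`_i.
  rewrite big_imset /=; last by move=> x y _ _; exact: h_inj.
  by apply: eq_bigl => i; rewrite inE.
pose H := h @: [set: 'I_k]; rewrite -/H.
have shift (S : {set 'I_n}) : #|S| = k ->
    \sum_(i in S) mu`_i = \sum_(i in S) (mu`_i - c) + k%:R * c.
  by move=> <-; rewrite sumrB sumr_const mulr_natl subrK.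
have cH : #|H| = k by rewrite card_imset // cardsT card_ord.
have ctop : #|top| = k.
  apply/eqP; rewrite -(eqr_nat R) -sum1_card natr_sum.
  by rewrite -(topE (fun=> 1%N%:R)) sumr_const card_ord.
rewrite (shift H) // (shift top) // lerD2r.
rewrite [leLHS]big_mkcond [leRHS]big_mkcond; apply: ler_sum => i _; rewrite inE.
case: (ltnP i k) => ik.
  case: ifP => // _; rewrite subr_ge0; apply: mu_le.
  by rewrite -[(i <= _)%N]ltnS prednK // ik /= (leq_trans _ kn) // ltn_predL.
case: ifP => // _; rewrite subr_le0; apply: mu_le.
by rewrite ltn_ord andbT (leq_trans (leq_pred k)).
Qed.

(** * Sums of the largest Laplacian eigenvalues *)

Lemma threshold_on_imset (V W : finType) (e : rel V) (e' : rel W) (f : V -> W)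
    (S : {set V}) :
  injective f -> (forall x y, e' (f x) (f y) = e x y) ->
  threshold_on e S -> threshold_on e' (f @: S).
Proof.
move=> f_inj ef; elim=> [x|{}S x _ IH xS iso|{}S x _ IH xS dom].
- by rewrite imset_set1; constructor.
- rewrite imsetU1; apply: threshold_isolated; rewrite ?mem_imset //.
  by move=> _ /imsetP[y yS ->]; rewrite ef iso.
- rewrite imsetU1; apply: threshold_dominating; rewrite ?mem_imset //.
  by move=> _ /imsetP[y yS ->]; rewrite ef dom.
Qed.

Lemma clique_number_imset (V W : finType) (e : rel V) (e' : rel W) (f : V -> W) :
  injective f -> (forall x y, e' (f x) (f y) = e x y) ->
  (clique_number e <= clique_number e')%N.
Proof.
move=> f_inj ef; apply/bigmax_leqP => K /forall_inP cK.
rewrite -(card_imset (mem K) f_inj).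
apply: (leq_bigmax_cond (F := fun K : {set W} => #|K|)).
apply/forall_inP => _ /imsetP[x xK ->]; apply/forall_inP => _ /imsetP[y yK ->].
by rewrite (inj_eq f_inj) ef; have /forall_inP := cK x xK; apply.
Qed.

Lemma sum_edges (V : finType) (e : rel V) : symmetric e -> irreflexive e ->
  (\sum_u \sum_v e u v = 2 * #|edges e|)%N.
Proof.
move=> e_sym e_irr.
rewrite pair_big /=.
transitivity (\sum_(p in [set p : V * V | e p.1 p.2]) 1)%N.
  by rewrite [RHS]big_mkcond; apply: eq_bigr => p _; rewrite inE; case: (e _ _).
rewrite (partition_big_imset (fun p : V * V => [set p.1; p.2])) /=.
rewrite mulnC -sum_nat_const; apply: eq_bigr => _ /imsetP[[a b] eab ->] /=.
have {}eab : e a b by rewrite inE in eab.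
have ne : a != b by apply: contraTneq eab => ->; rewrite e_irr.
transitivity #|[set (a, b); (b, a)]|; last by rewrite cards2 xpair_eqE negb_and ne.
rewrite -sum1_card; apply: eq_bigl => -[x y]; rewrite !inE /= !xpair_eqE.
apply/andP/orP => [[exy /eqP xy]|[|] /andP[/eqP -> /eqP ->]].
- have : x \in [set a; b] by rewrite -xy set21.
  have : y \in [set a; b] by rewrite -xy set22.
  have /negbTE xy' : x != y by apply: contraTneq exy => ->; rewrite e_irr.
  rewrite !inE; case/orP=> /eqP yp; case/orP=> /eqP xp; move: xy';
    rewrite yp xp ?eqxx // => _; by [left|right].
- by rewrite eab eqxx.
- by rewrite e_sym eab setUC eqxx.
Qed.

Section Spectrum.
Variables (R : realType) (n : nat) (e : rel 'I_n).
Hypotheses (e_sym : symmetric e) (e_irr : irreflexive e).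
Variable mu : n.-tuple R.
Hypothesis mu_spec : ordered_eigenvalues (laplacian R e) mu.

(** An eigenvector of a nonzero eigenvalue sums to 0, because the rows of the
    Laplacian do. Leaving out the zero eigenvalues does not affect the sum. *)
Lemma eigenframe_top k : (k <= n)%N ->
  exists j (Z : 'M[R]_(j, n)) (Lam : 'M[R]_j), (j <= k)%N /\
  [/\ row_free Z, Z *m laplacian R e = Lam *m Z, forall i, \sum_v Z i v = 0 &
    \tr Lam = \sum_(i < k) mu`_i].
Proof.
move=> kn; have [_ /(sym_diag (laplacian_sym R e_sym))[Q Qu QL]] := mu_spec.
pose P := [set i : 'I_n | (i < k)%N && (mu`_i != 0)].
pose f (i : 'I_#|P|) : 'I_n := enum_val i.
have QLi i v : \sum_u Q i u * laplacian R e u v = mu`_i * Q i v.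
  have := congr1 (fun M : 'M_n => M i v) QL.
  by rewrite mxE => ->; rewrite mul_diag_mx !mxE.
exists #|P|, (rowsub f Q), (diag_mx (\row_i mu`_(f i))); split.
  have -> : k = #|[set i : 'I_n | (i < k)%N]|.
    rewrite -sum1_card -[LHS]card_ord -sum1_card (big_ord_widen n (fun=> 1%N) kn).
    by apply: eq_bigl => i; rewrite inE.
  by apply/subset_leq_card/subsetP => i; rewrite !inE => /andP[].
split.
- apply/row_freeP; exists (colsub f (invmx Q)).
  apply/matrixP => i l; rewrite mul_rowsub_mx mulmx_colsub mulmxV // !mxE.
  by rewrite (inj_eq enum_val_inj).
- rewrite mul_rowsub_mx QL; apply/matrixP => i v.
  by rewrite !mul_diag_mx !mxE.
- move=> i; have : f i \in P by exact: enum_valP.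
  rewrite inE => /andP[_ mui]; apply: (mulfI mui); rewrite mulr0 mulr_sumr.
  under eq_bigr do rewrite mxE -QLi.
  rewrite exchange_big big1 // => u _.
  by rewrite -mulr_sumr laplacian_sum0 mulr0.
rewrite mxtrace_diag (big_ord_widen n (fun i => mu`_i) kn).
under eq_bigr do rewrite mxE.
rewrite -(big_enum_val (fun i : 'I_n => mu`_i)) /=.
rewrite [RHS]big_mkcond [LHS]big_mkcond; apply: eq_bigr => i _.
by rewrite inE; case: (i < k)%N => //=; case: eqP => // ->.
Qed.

Lemma top_sum_le k : (k <= n)%N ->
  2 * \sum_(i < k) mu`_i <= k%:R ^+ 2 + k%:R + \sum_u \sum_v (e u v)%:R.
Proof.
move=> /eigenframe_top[j [Z [Lam [jk [Zf ZL Z0 <-]]]]].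
apply: le_trans (brouwer_le e_sym Zf ZL Z0) _; rewrite lerD2r.
by rewrite lerD ?ler_nat // lerXn2r ?nnegrE ?ler0n // ler_nat.
Qed.

(** The bound for [j] rows increases strictly with [j], so that equality for [k]
    forces all [k] rows to be present. *)
Lemma top_sum_eq k : (0 < k <= n)%N ->
  2 * \sum_(i < k) mu`_i = k%:R ^+ 2 + k%:R + \sum_u \sum_v (e u v)%:R ->
  exists X, [/\ nested_split e X, #|X| = k &
    forall a, a \in X -> exists2 b, b \notin X & e a b].
Proof.
case/andP=> k_gt0 /eigenframe_top[j [Z [Lam [jk [Zf ZL Z0 <-]]]]] eqL.
have jE : j = k.
  apply/eqP; rewrite eqn_leq jk /= leqNgt; apply/negP => jk'.
  have := brouwer_le e_sym Zf ZL Z0; rewrite eqL lerD2r leNgt => /negP[].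
  rewrite ltr_leD ?ler_nat // ?(ltW jk') //.
  by rewrite ltrXn2r ?nnegrE ?ler0n ?ltr_nat // .
by subst j; exact: (brouwer_eq e_sym e_irr Zf ZL Z0).
Qed.

(** The invariant space of the threshold graph exhibits [k] eigenvalues whose sum
    reaches the bound, and the [k] largest have at least that sum. *)
Lemma top_sum_threshold k : (k <= n)%N -> threshold e -> clique_number e = k.+1 ->
  2 * \sum_(i < k) mu`_i = k%:R ^+ 2 + k%:R + \sum_u \sum_v (e u v)%:R.
Proof.
move=> kn /(threshold_eigenframe R e_sym e_irr)[_ [j [[Z [Lam [Zf]]]]]].
have -> : laplacian R (induced e setT) = laplacian R e.
  congr laplacian; apply/boolp.funext => u; apply/boolp.funext => v.
  by rewrite /induced !inE.
move=> ZL Z0 _ trL [K [_ cK sK]] maxK cE.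
have jE : j = k.
  apply/eqP; rewrite -eqSS -cE eqn_leq; apply/andP; split.
    by rewrite -sK (leq_bigmax_cond (F := fun K : {set 'I_n} => #|K|)).
  by apply/bigmax_leqP => K' /maxK; apply; exact: subsetT.
have [mu_sorted /(sym_diag (laplacian_sym R e_sym))[Q Qu QL]] := mu_spec.
have [h h_inj trE] := invariant_trace Qu QL Zf ZL.
apply: le_anti; rewrite top_sum_le //= -jE.
have -> : \sum_u \sum_v (e u v)%:R =
          \sum_u \sum_v (induced e setT u v)%:R :> R.
  by apply: eq_bigr => u _; apply: eq_bigr => v _; rewrite /induced !inE.
rewrite -trL ler_pM2l ?ltr0n // trE.
rewrite (eq_bigr (fun i => mu`_(h i))) => [|i _]; last by rewrite mxE.
exact: sum_top_le.
Qed.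

Theorem top_sum_iff k : (0 < k <= n)%N ->
  2 * \sum_(i < k) mu`_i = k%:R ^+ 2 + k%:R + \sum_u \sum_v (e u v)%:R <->
  threshold e /\ clique_number e = k.+1.
Proof.
move=> k_itv; have /andP[k_gt0 kn] := k_itv; split; last first.
  by case; exact: top_sum_threshold.
move=> /(top_sum_eq k_itv)[X [splitX cX nbr]]; split.
  apply: threshold_nested_split splitX _ => //.
  by apply/set0Pn; exists (Ordinal (leq_trans k_gt0 kn)); rewrite inE.
by rewrite -(prednK k_gt0) in cX *; exact: clique_number_nested_split cX nbr.
Qed.
End Spectrum.

Theorem theorem1p1 (R : realType) (V : finType) (e : rel V)
    (e_sym : symmetric e) (e_irr : irreflexive e)
    (mu : #|V|.-tuple R) (mu_spec : ordered_eigenvalues (laplacian_mx e R) mu)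
    (k : nat) (k_gt0 : (0 < k)%N) (k_lt : (k < #|V|)%N) :
  \sum_(i < k) mu`_i = (#|edges e| + 'C(k.+1, 2))%:R
  <-> (threshold e /\ clique_number e = k.+1).
Proof.
pose e' : rel 'I_#|V| := fun i j => e (enum_val i) (enum_val j).
have e'_sym : symmetric e' by move=> i j; exact: e_sym.
have e'_irr : irreflexive e' by move=> i; exact: e_irr.
have e'E x y : e' (enum_rank x) (enum_rank y) = e x y.
  by rewrite /e' !enum_rankK.
have ee' i j : e (enum_val i) (enum_val j) = e' i j by [].
have lapE : laplacian_mx e R = laplacian R e'.
  apply/matrixP => i j; rewrite !mxE; congr (_ - _).
  rewrite /degree -sum1_card natr_sum mulr_natl mulrb.
  case: eqP => _; rewrite ?mulr0n // mulr1n.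
  rewrite big_mkcond /= (reindex _ (onW_bij _ (enum_val_bij V))) /=.
  by apply: eq_bigr => x _; rewrite inE /e'; case: (e _ _).
rewrite lapE in mu_spec.
have sumE : \sum_u \sum_v (e' u v)%:R = 2 * #|edges e|%:R :> R.
  rewrite -natrM -(sum_edges e_sym e_irr) natr_sum.
  rewrite [RHS](reindex _ (onW_bij _ (enum_val_bij V))).
  apply: eq_bigr => u _; rewrite natr_sum.
  by rewrite [RHS](reindex _ (onW_bij _ (enum_val_bij V))).
have thrE : threshold e <-> threshold e'.
  have imT (A B : finType) (f : A -> B) g : cancel g f -> f @: setT = setT.
    move=> gf; apply/setP => x; rewrite !inE.
    by apply/imsetP; exists (g x); rewrite ?inE ?gf.
  split; rewrite /threshold.
    rewrite -(imT _ _ _ _ (@enum_valK V)).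
    exact: threshold_on_imset (@enum_rank_inj V) e'E.
  rewrite -(imT _ _ _ _ (@enum_rankK V)).
  exact: threshold_on_imset enum_val_inj ee'.
have cliqueE : clique_number e = clique_number e'.
  apply/eqP; rewrite eqn_leq (clique_number_imset (@enum_rank_inj V) e'E).
  by rewrite (clique_number_imset enum_val_inj ee').
have binE : k%:R ^+ 2 + k%:R = 2 * ('C(k.+1, 2))%:R :> R.
  have /(congr1 (fun m => m%:R : R)) := mul_bin_diag k.+1 1.
  by rewrite /= bin1 !natrM => <-; rewrite -natr1; ring.
have k_itv : (0 < k <= #|V|)%N by rewrite k_gt0 ltnW.
have main := top_sum_iff e'_sym e'_irr mu_spec k_itv.
rewrite sumE binE in main; rewrite cliqueE natrD; split.
  by move=> h; have [|/thrE] := main.1; first by rewrite h; ring.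
by case=> /thrE thr cl; have := main.2 (conj thr cl); lra.
Qed.
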